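(* Let $p,q,r,s$ be prime numbers with $p \equiv q \equiv r \equiv 3 \pmod 4$ and $qrs \equiv 1 \pmod 4$. Assume that it is not the case that $\left(\frac{q}{s}\right) = \left(\frac{r}{s}\right) = 1$. If $\left(\frac{2}{s}\right) = -1$, $\left(\frac{p}{s}\right) \neq \left(\frac{2}{s}\right)$, and $\left(\frac{qr}{p}\right) = \left(\frac{pr}{q}\right) = -1$, then the bi-quadratic field $\mathbb{Q}(\sqrt{p}, \sqrt{qrs})$ is a Pólya field. Moreover, the condition $\left(\frac{pr}{q}\right) = -1$ is redundant if $\left(\frac{q}{s}\right) = \left(\frac{r}{s}\right) = -1$; that is, if $\left(\frac{q}{s}\right) = \left(\frac{r}{s}\right) = -1$, $\left(\frac{2}{s}\right) = -1$, $\left(\frac{p}{s}\right) \neq \left(\frac{2}{s}\right)$ and $\left(\frac{qr}{p}\right) = -1$, then $\mathbb{Q}(\sqrt{p}, \sqrt{qrs})$ is a Pólya field.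
   Context: Here $\left(\frac{a}{\ell}\right)$ is the Legendre symbol for an odd prime $\ell$. For a number field $K$ with ring of integers $\mathcal{O}_K$, a prime number $\ell$ and an integer $f\ge 1$, the Ostrowski ideal $\Pi_{\ell^f}(K)$ is the product of all maximal ideals $\mathfrak{m}$ of $\mathcal{O}_K$ with norm $N_{K/\mathbb{Q}}(\mathfrak{m}) = \ell^f$ (equal to $\mathcal{O}_K$ if there are none). The Pólya group $Po(K)$ is the subgroup of the ideal class group of $K$ generated by the classes of all Ostrowski ideals of $K$. $K$ is a Pólya field if all its Ostrowski ideals are principal, equivalently if $Po(K)$ is trivial. *)

(* Defs.v *)
From HB Require Import structures.
From mathcomp Require Import all_boot all_order all_algebra all_field.
From mathcomp Require Import boolp classical_sets functions cardinality fsbigop.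

Set Implicit Arguments.
Unset Strict Implicit.
Unset Printing Implicit Defensive.

Import GRing.Theory.
Local Open Scope ring_scope.
Local Open Scope classical_set_scope.

Definition legendre (a : int) (l : nat) : int :=
  if (l %| a)%Z then 0
  else if `[< exists x : int, (x ^+ 2 = a %[mod l])%Z >] then 1 else -1.

Section RingOfIntegers.
Variable K : fieldExtType rat.

Definition integer_pred : {pred K} :=
  fun x => `[< integralOver (intr : int -> K) x >].

Lemma integer_predP x :
  reflect (integralOver (intr : int -> K) x) (x \in integer_pred).
Proof. exact: asboolP. Qed.

Lemma integer_subring : subring_closed integer_pred.
Proof.
split=> [|x y /integer_predP hx /integer_predP hy
         |x y /integer_predP hx /integer_predP hy]; apply/integer_predP.
- exact: integral1.
- exact: integral_sub.
- exact: integral_mul.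
Qed.

HB.instance Definition _ := GRing.isSubringClosed.Build K integer_pred
  integer_subring.

Record ringOfIntegers := RingOfIntegers {
  integer_val :> K;
  integer_valP : integer_val \in integer_pred }.

HB.instance Definition _ := [isSub for integer_val].
HB.instance Definition _ := [Choice of ringOfIntegers by <:].
HB.instance Definition _ := [SubChoice_isSubComNzRing of ringOfIntegers by <:].

End RingOfIntegers.

Section Ideals.
Variable R : comNzRingType.
Implicit Types (I J : set R) (n : nat).

(* [idealr_closed] only holds of proper ideals: it requires that 1 is not a
   member. *)
Definition maximal_ideal I : Prop :=
  idealr_closed (mem I) /\
  forall J, idealr_closed (mem J) -> I `<=` J -> J = I.

Definition principal_ideal I : Prop :=
  exists a : R, I = [set a * x | x in [set: R]].

Definition ideal_mul I J : set R :=
  [set z | exists2 s : seq (R * R),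
     (forall u, u \in s -> I u.1 /\ J u.2) & z = \sum_(u <- s) u.1 * u.2].

Definition ideal_cosets I : set (set R) :=
  [set [set y | I (y - x)] | x in [set: R]].

(* The norm of I is the cardinality of the quotient R/I. *)
Definition ideal_norm_is I n : Prop := (ideal_cosets I #= `I_n)%card.

End Ideals.

(* The finitely supported big operator is the genuine product here: a number
   field has finitely many maximal ideals of a given norm, and none of them is
   the neutral element [set: _]. *)
Definition ostrowski_ideal (K : fieldExtType rat) (l f : nat) :
    set (ringOfIntegers K) :=
  \big[@ideal_mul (ringOfIntegers K)/[set: ringOfIntegers K]]_(m \in
     [set m : set (ringOfIntegers K)
        | maximal_ideal m /\ ideal_norm_is m (l ^ f)%N]) m.

Arguments ostrowski_ideal : clear implicits.

Definition polya_field (K : fieldExtType rat) : Prop :=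
  forall l f : nat, prime l -> (0 < f)%N ->
    principal_ideal (ostrowski_ideal K l f).

(* Main.v *)
Require Import Defs.
From mathcomp Require Import all_boot all_order all_algebra all_field.
From HB Require Import structures.
From mathcomp Require Import all_fingroup all_solvable.
From mathcomp Require Import boolp classical_sets functions cardinality fsbigop.
From mathcomp Require Import zify ring lra.

Import Order.TTheory GRing.Theory Num.Theory.
Local Open Scope ring_scope.

(** Write D = qrs, so that D is 1 mod 4, and let K be generated by the square
    roots of p and D. The primes that ramify in K are 2, p, q, r and s, all with
    ramification index 2. If l does not ramify, the product of the maximal
    ideals over l is (l). If l ramifies, the square of that product is (l), so
    the product is principal as soon as l is the square of an integer of K up to
    a unit. Since K is Galois, all maximal ideals over l have the same norm, and
    every Ostrowski ideal is either the unit ideal or such a product. It thus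
    suffices to show [assoc_square K l] for the five ramified primes
    ([biquadratic_polya]).

    The integers that are squares up to a unit form a group modulo rational
    squares, and Pell's equation produces elements of it. If E is odd and
    squarefree, a smallest solution of x^2 - E y^2 = 1 splits into a nontrivial
    relation d1 a^2 - d2 b^2 = e with d1 d2 = E and e equal to 1 or 2
    ([pell_descent]). When K contains a square root c of E, the square of
    d1 a + b c is then e d1 times a unit. For E = p this gives 2. For E = D it
    gives a factor of D other than 1 and D, so, modulo D, one of q, r, s. For
    E = pD it gives a third factor. The relation reads as a condition on Legendre
    symbols at each prime dividing E ([pell_primes]), and the hypotheses leave
    no possibility for the third factor to depend on 2, p, D and the second one
    ([subgroup_primes]): hence q, r and s are all squares up to a unit. The
    reciprocity laws that are needed come out of [pell_primes] as well, applied
    to products of one or two primes; Pell's equation itself is solved by the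
    periodicity of a reduction of indefinite binary forms ([pell]).

    The ideal theory avoids factorization into primes. The ring of integers of K
    carries two commuting involutions whose common fixed ring is the ring of
    rational integers. If x lies in all the maximal ideals over l, then so do
    the conjugates of its multiples, and their traces to the rational integers
    are in lZ. Climbing a tower of two quadratic extensions unramified at l, this
    shows that l divides x ([over_rad_unramified]). When only one step of the tower is
    unramified, the same argument applied to the relative trace and norm of x
    shows that l divides x^2 ([over_rad_sqr]), so that a square root of l up to a
    unit divides x. *)

(** * Pell's equation from the river of an indefinite form *)

(** Injectivity excludes a preperiod: an orbit that stays in a finite set must come
    back to its origin. *)
Lemma orbit_returns (A : Type) (T : finType) (P : A -> Prop) (f : A -> A)
    (code : A -> T) (a : A) :
  (forall x, P x -> P (f x)) ->
  (forall x y, P x -> P y -> f x = f y -> x = y) ->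
  (forall x y, P x -> P y -> code x = code y -> x = y) ->
  P a -> exists n, iter n.+1 f a = a.
Proof.
move=> Pf f_inj code_inj Pa.
have Pit n : P (iter n f a) by elim: n => //= n; apply: Pf.
(* An equality between later iterates can be cancelled step by step. *)
have back m k : iter m f (iter k f a) = iter m f a -> iter k f a = a.
  elim: m => //= m IH /f_inj eqm; apply: IH; apply: eqm; last exact: Pit.
  by rewrite -iterD; apply: Pit.
have /injectivePn [i [j neq_ij eq_ij]] :
    ~~ injectiveb (fun i : 'I_#|T|.+1 => code (iter i f a)).
  apply/injectiveP => inj; have := leq_card _ inj.
  by rewrite card_ord ltnn.
have {}eq_ij : iter i f a = iter j f a by apply: code_inj.
wlog lt_ij : i j neq_ij eq_ij / (i < j)%N.
  move=> H; case: (ltngtP i j) => [lt|lt|/val_inj eq]; first exact: (H i j).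
    by apply: (H j i) => //; rewrite eq_sym.
  by rewrite eq eqxx in neq_ij.
exists (j - i).-1; rewrite prednK ?subn_gt0 //; apply: (back i).
by rewrite -iterD subnKC // ltnW.
Qed.

Section River.
Variable D : nat.
Hypothesis D_gt0 : (0 < D)%N.
Hypothesis D_nonsquare : forall x : int, x ^+ 2 <> D%:Z.

(** A pair of vectors (x, y), (z, w) is read as a basis of the integer plane, and the
    triple (a, b, c) as the Gram matrix of the form x^2 - D y^2 on it: a and c are
    the values of the form on the basis and b is the polar value. *)
Definition river_form (M : int * int * (int * int)) : int * int * int :=
  let: (x, y, (z, w)) := M in
  (x ^+ 2 - D%:Z * y ^+ 2, x * z - D%:Z * (y * w), z ^+ 2 - D%:Z * w ^+ 2).

Definition form_step (F : int * int * int) : int * int * int :=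
  let: (a, b, c) := F in
  let d := a + 2 * b + c in
  if 0 < d then (d, b + c, c) else (a, a + b, d).

(** One step along Conway's river: the sum of the two basis vectors replaces the one
    on which the form has the same sign as on the sum. *)
Definition river_step (M : int * int * (int * int)) :=
  let: (x, y, (z, w)) := M in
  let: (a, b, c) := river_form M in
  if 0 < a + 2 * b + c then (x + z, y + w, (z, w)) else (x, y, (x + z, y + w)).

Definition river_state (F : int * int * int) : Prop :=
  let: (a, b, c) := F in [/\ 0 < a, c < 0 & b ^+ 2 - a * c = D%:Z].

Lemma river_form_step M : river_form (river_step M) = form_step (river_form M).
Proof.
move: M => [[x y] [z w]] /=; case: ifP => _; congr (_, _, _); ring.
Qed.

(** The new value is not 0 since a + 2b + c = 0 would make D = (b + c)^2. *)
Lemma form_step_state F : river_state F -> river_state (form_step F).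
Proof.
move: F => [[a b] c] [a_gt0 c_lt0 dE] /=.
have d_neq0 : a + 2 * b + c <> 0.
  move=> d0; apply: (D_nonsquare (b + c)).
  by rewrite -dE -[RHS]addr0 -(mulr0 c) -d0; ring.
by case: ifP => [d_gt0|/negP d_le0]; split=> //; try (rewrite -dE; ring); lia.
Qed.

(** The step can be undone: the sign of a - 2b + c tells which of the two vectors was
    replaced, as this quantity is the old a in one case and the old c in the other. *)
Lemma form_step_inj F G :
  river_state F -> river_state G -> form_step F = form_step G -> F = G.
Proof.
move: F G => [[a b] c] [[a' b'] c'] [a0 c0 _] [a0' c0' _] /=.
by case: ifP => [|/negP] d; case: ifP => [|/negP] d' [E1 E2 E3];
  congr (_, _, _); lia.
Qed.

Definition form_code (F : int * int * int) : 'I_D.+1 * 'I_D.+1 * 'I_D.+1 * bool :=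
  let: (a, b, c) := F in
  (inord `|a|%N, inord `|b|%N, inord `|c|%N, b < 0).

(** D = b^2 + a (- c) bounds a, |b| and - c by D, so there are finitely many states. *)
Lemma form_code_inj F G :
  river_state F -> river_state G -> form_code F = form_code G -> F = G.
Proof.
move: F G => [[a b] c] [[a' b'] c'] [a0 c0 dE] [a0' c0' dE'] /=.
have bound (u v w : int) : 0 < u -> w < 0 -> v ^+ 2 - u * w = D%:Z ->
    [/\ `|u| < D.+1, `|v| < D.+1 & `|w| < D.+1]%N.
  move=> u0 w0 E.
  have sq : `|v|%:Z <= v ^+ 2 by nia.
  have ww : u <= - (u * w) by nia.
  have uu : - w <= - (u * w) by nia.
  by split; lia.
have [? ? ?] := bound _ _ _ a0 c0 dE; have [? ? ?] := bound _ _ _ a0' c0' dE'.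
case=> /(congr1 val) /= + /(congr1 val) /= + /(congr1 val) /= + Eb.
rewrite !inordK // => Ea Eb' Ec; congr (_, _, _); lia.
Qed.

(** When the river is back at its first state, the first basis vector again has value
    1 and thus solves the equation. Each step increases the entries of the
    basis, which rules out the trivial solution. *)
Lemma pell : exists x y : nat, (0 < y)%N /\ (x ^ 2 = D * y ^ 2 + 1)%N.
Proof.
pose M0 : int * int * (int * int) := (1, 0, (0, 1)).
have st0 : river_state (river_form M0) by split=> //=; lia.
have [n Hn] := orbit_returns _ _ river_state form_step form_code (river_form M0)
  form_step_state form_step_inj form_code_inj st0.
pose M k := iter k river_step M0.
have formM k : river_form (M k) = iter k form_step (river_form M0).
  by elim: k => //= k <-; rewrite river_form_step.
have invM k : let: (x, y, (z, w)) := M k in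
    [/\ 0 < x, 0 <= y, 0 <= z & 0 < w] /\ x * w - y * z = 1 /\ x + w + y + z >= 2 + k%:Z.
  elim: k => [|k]; first by rewrite /M /=; split; [split|split].
  rewrite /M iterS -/(M k) /=; case: (M k) => [[x y] [z w]] /= [[x0 y0 z0 w0] [E S]].
  by case: ifP => _; (split; [split|split]); lia.
have := invM n.+1; have := formM n.+1; rewrite Hn.
case: (M n.+1) => [[x y] [z w]] /= [E1 E2 E3] [[x0 y0 z0 w0] [E S]].
exists `|x|%N, `|y|%N; split; last by nia.
(* If y = 0 then x = 1, and the zero polar value forces the initial basis. *)
rewrite absz_gt0; apply/negP => /eqP y_eq0; move: E1 E2 E; rewrite y_eq0.
nia.
Qed.
End River.

(** * Splitting the discriminant by a smallest Pell solution *)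

Definition squarefree (D : nat) : Prop := forall l : nat, prime l -> ~~ (l ^ 2 %| D)%N.

Section Nats.
Local Open Scope nat_scope.

(** The square root of u is u1 = u / gcd(u, w): removing gcd(u, w) from both sides
    shows that gcd(u, w) = h u1, and h divides both u and v. *)
Lemma coprime_mul_square u v w :
  coprime u v -> u * v = w ^ 2 -> (exists a, u = a ^ 2) /\ (exists b, v = b ^ 2).
Proof.
have [->|u_gt0] := posnP u.
  rewrite /coprime gcd0n => /eqP -> _; split; [by exists 0|by exists 1].
have g_gt0 : 0 < gcdn u w by rewrite gcdn_gt0 u_gt0.
set g := gcdn u w in g_gt0 *; move=> co_uv uvE.
have /dvdnP[u1 uE] : g %| u by apply: dvdn_gcdl.
have /dvdnP[w1 wE] : g %| w by apply: dvdn_gcdr.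
have co_uw : coprime u1 (w1 ^ 2).
  rewrite coprimeXr // /coprime -(eqn_pmul2r g_gt0) mul1n muln_gcdl -uE -wE.
  by rewrite -/g.
have E : u1 * v = g * w1 ^ 2.
  by apply/eqP; rewrite -(eqn_pmul2l g_gt0); apply/eqP; move: uvE; rewrite uE wE; nia.
have /dvdnP[h gE] : u1 %| g.
  by rewrite -(Gauss_dvdl _ co_uw) -E dvdn_mulr.
have u1_gt0 : 0 < u1 by move: u_gt0; rewrite uE; case: (u1).
have vE : v = h * w1 ^ 2.
  by apply/eqP; rewrite -(eqn_pmul2l u1_gt0); apply/eqP; rewrite E gE; nia.
have h1 : h = 1.
  have : h %| gcdn u v by rewrite dvdn_gcd vE uE gE mulnCA !dvdn_mulr.
  by rewrite (eqP co_uv) dvdn1 => /eqP.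
by split; [exists u1|exists w1]; rewrite ?vE ?uE ?gE h1 !mul1n // mulnn.
Qed.

Lemma squarefree_coprime_mul D u v w :
    squarefree D -> 0 < D -> coprime u v -> u * v = D * w ^ 2 ->
  exists d1 d2 a b, [/\ d1 * d2 = D, u = d1 * a ^ 2 & v = d2 * b ^ 2].
Proof.
move=> sqfD D_gt0 co_uv uvE.
have d1_gt0 : 0 < gcdn u D by rewrite gcdn_gt0 D_gt0 orbT.
set d1 := gcdn u D in d1_gt0 *.
have /dvdnP[u1 uE] : d1 %| u by apply: dvdn_gcdl.
have /dvdnP[d2 DE] : d1 %| D by apply: dvdn_gcdr.
have co_ud : coprime d2 u1.
  rewrite /coprime; apply: contraT => neq1.
  have l_pr : prime (pdiv (gcdn d2 u1)).
    have d2_gt0 : 0 < d2 by move: D_gt0; rewrite DE; case: (d2).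
    by apply: pdiv_prime; rewrite ltn_neqAle eq_sym neq1 gcdn_gt0 d2_gt0.
  set l := pdiv _ in l_pr; have := pdiv_dvd (gcdn d2 u1).
  rewrite -/l dvdn_gcd => /andP[l_d2 l_u1].
  have l_d1 : l %| d1 by rewrite dvdn_gcd uE DE dvdn_mulr // dvdn_mulr.
  by have := sqfD l l_pr; rewrite DE expnS expn1 dvdn_mul.
have E : u1 * v = d2 * w ^ 2.
  by apply/eqP; rewrite -(eqn_pmul2l d1_gt0); apply/eqP; move: uvE; rewrite uE DE; nia.
have /dvdnP[v1 vE] : d2 %| v.
  by rewrite -(Gauss_dvdr _ co_ud) E dvdn_mulr.
have d2_gt0 : 0 < d2 by move: D_gt0; rewrite DE; case: (d2).
have [] := coprime_mul_square u1 v1 w.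
- by move: co_uv; rewrite uE vE coprimeMl coprimeMr => /andP[/andP[]].
- by apply/eqP; rewrite -(eqn_pmul2l d2_gt0); apply/eqP; move: E; rewrite vE; nia.
move=> [a uE'] [b vE']; exists d1, d2, a, b.
by rewrite uE vE uE' vE' DE; split=> //; apply: mulnC.
Qed.

Lemma squarefree_nonsquare D (x : int) :
  squarefree D -> 1 < D -> (x ^+ 2)%R <> D%:Z.
Proof.
move=> sqfD D_gt1 xE.
have {xE}DE : `|x| ^ 2 = D by nia.
have l_pr := pdiv_prime D_gt1; have := sqfD _ l_pr.
have := pdiv_dvd D; rewrite -{2}DE Euclid_dvdX //= andbT => /dvdnP[k xE].
by rewrite -{2}DE xE expnMn dvdn_mull.
Qed.

(** From D y^2 = (x - 1)(x + 1), where the factors, halved if x is odd, are coprime,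
    so that each is a square times a divisor of D. The case d1 = e = 1 is a Pell
    solution again, with a smaller y. *)
Lemma pell_descent D : squarefree D -> 1 < D -> odd D ->
  exists d1 d2 a b e : nat, [/\ d1 * d2 = D, d1 * a ^ 2 = d2 * b ^ 2 + e,
    e = 1 \/ e = 2 & d1 = 1 -> e = 2].
Proof.
move=> sqfD D_gt1 D_odd; have D_gt0 := ltnW D_gt1.
have [x [y [y_gt0 xyE]]] :=
  pell D D_gt0 (fun x => squarefree_nonsquare D x sqfD D_gt1).
elim/ltn_ind: y x y_gt0 xyE => y IH x y_gt0 xyE.
have x_gt1 : 1 < x by nia.
case: (boolP (odd x)) => x_odd.
  have y_even : ~~ odd y.
    by move: (congr1 odd xyE); rewrite !oddD oddM !oddX x_odd D_odd /=; case: odd.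
  (* Both x - 1 = 2 v and x + 1 = 2 (v + 1) are even. *)
  pose v := x./2; pose w := y./2.
  have xE : x = 2 * v + 1 by rewrite /v; lia.
  have yE : y = 2 * w by rewrite /w; lia.
  have uvE : v.+1 * v = D * w ^ 2 by move: xyE; rewrite xE yE; nia.
  have [d1 [d2 [a [b [dE uE vE]]]]] :=
    squarefree_coprime_mul D _ _ w sqfD D_gt0 (coprimeSn v) uvE.
  have eqE : d1 * a ^ 2 = d2 * b ^ 2 + 1 by rewrite -uE -vE addn1.
  case: (eqVneq d1 1) => [d1E|d1_neq1]; last first.
    by exists d1, d2, a, b, 1; split=> //; [left|move=> d1E; rewrite d1E in d1_neq1].
  rewrite d1E !mul1n in dE uE eqE; subst d2.
  apply: (IH b _ a) => //.
    have : D * b ^ 2 < D * y ^ 2 by rewrite -vE; move: xyE; rewrite xE; nia.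
    by rewrite ltn_pmul2l // ltn_sqr.
  rewrite lt0n; apply/eqP => b0; move: vE; rewrite b0 muln0; lia.
(* Now x is even, so x - 1 and x + 1 are odd and differ by 2. *)
have co_uv : coprime x.+1 x.-1.
  have -> : x.+1 = x.-1 + 2 by lia.
  by rewrite coprime_sym /coprime gcdnDl -/(coprime _ _) coprimen2; lia.
have uvE : x.+1 * x.-1 = D * y ^ 2 by nia.
have [d1 [d2 [a [b [dE uE vE]]]]] := squarefree_coprime_mul D _ _ y sqfD D_gt0 co_uv uvE.
exists d1, d2, a, b, 2; split=> //; [by rewrite -uE -vE; lia|by right].
Qed.
End Nats.

(** * Quadratic residues modulo a prime *)

(** The second property says that g has order l - 1. *)
Lemma Fp_generator (l : nat) : prime l ->
  exists2 g : 'F_l, g != 0 &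
    (forall x : 'F_l, x != 0 -> exists k, x = g ^+ k) /\
    (forall n, g ^+ n = 1 -> (l.-1 %| n)%N).
Proof.
move=> l_pr; have /cyclicP[u uE] := field_unit_group_cyclic [set: {unit 'F_l}]%G.
exists (val u); first by rewrite -unitfE (valP u).
split=> [x|n un1].
  rewrite -unitfE => Ux; have : FinRing.unit 'F_l Ux \in [set: {unit 'F_l}] by rewrite inE.
  by rewrite uE => /cycleP[k /(congr1 val)]; rewrite /= FinRing.val_unitX => ->; exists k.
rewrite -(card_Fp l_pr) -card_finField_unit uE -orderE order_dvdn.
by apply/eqP/val_inj; rewrite FinRing.val_unitX.
Qed.

(** Booleans under exclusive or turn the multiplicativity of the Legendre symbol into
    linear algebra over the field with two elements. *)
Definition nonres (l : nat) (a : int) : bool := legendre a l == -1.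

Section Nonresidues.
Variable l : nat.
Hypothesis l_pr : prime l.

Lemma eqz_mod_Fp (a b : int) : (a == b %[mod l])%Z = (a%:~R == b%:~R :> 'F_l).
Proof.
by rewrite eqz_mod_dvd (dvdz_pcharf (pchar_Fp l_pr)) rmorphB subr_eq0.
Qed.

Lemma nonresE (a : int) : nonres l a =
  (a%:~R != 0 :> 'F_l) && ~~ [exists y : 'F_l, y ^+ 2 == a%:~R].
Proof.
rewrite /nonres /legendre (dvdz_pcharf (pchar_Fp l_pr)); have [//|_ /=] := eqVneq (a%:~R : 'F_l) 0.
case: ifPn => [/asboolP[x /eqP]|/asboolPn noroot].
  rewrite eqz_mod_Fp rmorphXn /= => xE.
  by apply/esym/negbTE; rewrite negbK; apply/existsP; exists x%:~R.
rewrite eqxx; apply/esym/negP => /existsP[y yE]; apply: noroot; exists (Posz (val y)).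
by apply/eqP; rewrite eqz_mod_Fp rmorphXn /= -pmulrn natr_Zp.
Qed.

Lemma nonres_eqmod (a b : int) : (l %| a - b)%Z -> nonres l a = nonres l b.
Proof.
by rewrite -eqz_mod_dvd eqz_mod_Fp => /eqP ab; rewrite !nonresE ab.
Qed.

Lemma nonresM (a b : int) : ~~ (l %| a)%Z -> ~~ (l %| b)%Z ->
  nonres l (a * b) = nonres l a (+) nonres l b.
Proof.
rewrite !(dvdz_pcharf (pchar_Fp l_pr)) => a0 b0.
rewrite !nonresE rmorphM mulf_neq0 ?a0 ?b0 //=.
move: (a%:~R) (b%:~R) a0 b0 => {a b} a b a0 b0.
have [g g0 [gP _]] := Fp_generator l l_pr.
have [i iE] := gP a a0; have [j jE] := gP b b0.
have square_exp k : (odd k == false) -> [exists y : 'F_l, y ^+ 2 == g ^+ k].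
  move=> /eqP k_even; apply/existsP; exists (g ^+ k./2).
  by rewrite -exprM muln2 -[in X in _ == X](odd_double_half k) k_even.
have squareM (x y : 'F_l) : x != 0 -> [exists z, z ^+ 2 == x] ->
    [exists z, z ^+ 2 == x * y] = [exists z, z ^+ 2 == y].
  move=> x0 /existsP[z /eqP zE]; have z0 : z != 0 by rewrite -sqrf_eq0 zE.
  apply/existsP/existsP => [[t /eqP tE]|[t /eqP tE]].
    by exists (t / z); rewrite expr_div_n tE zE mulrAC mulfV // mul1r.
  by exists (z * t); rewrite exprMn tE zE.
case: (boolP [exists y, y ^+ 2 == a]) => [sqa|nsqa] /=; first by rewrite squareM.
case: (boolP [exists y, y ^+ 2 == b]) => [sqb|nsqb] /=.
  by rewrite mulrC squareM // nsqa.
rewrite iE jE -exprD square_exp // oddD.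
case: (boolP (odd i)) nsqa => [_ _|i_even]; last by rewrite iE square_exp // (negbTE i_even).
by case: (boolP (odd j)) nsqb => [_ _|j_even] //; rewrite jE square_exp // (negbTE j_even).
Qed.

Lemma nonres_sqr (a : int) : nonres l (a ^+ 2) = false.
Proof.
rewrite nonresE rmorphXn /=; apply/negbTE; rewrite negb_and !negbK.
by apply/orP; right; apply/existsP; exists a%:~R.
Qed.

Lemma nonres1 : nonres l 1 = false.
Proof. by rewrite -(expr1n _ 2) nonres_sqr. Qed.

Lemma dvdz_primeM (a b : int) : (l %| a * b)%Z = (l %| a)%Z || (l %| b)%Z.
Proof. by rewrite !(dvdz_pcharf (pchar_Fp l_pr)) rmorphM mulf_eq0. Qed.

(** The value e of the form is a square times m modulo l. *)
Lemma nonres_represented (m n x y e : int) :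
  m * x ^+ 2 = n * y ^+ 2 + e -> (l %| n)%Z -> ~~ (l %| e)%Z ->
  nonres l m = nonres l e.
Proof.
move=> E ln le.
have E' : (l %| m * x ^+ 2 - e)%Z by rewrite E addrK dvdz_mulr.
have lmx : ~~ (l %| m * x ^+ 2)%Z.
  apply: contra le => lmx.
  have -> : e = m * x ^+ 2 - n * y ^+ 2 by rewrite E; ring.
  by apply: rpredB => //; apply: dvdz_mulr.
rewrite -(nonres_eqmod _ _ E'); move: lmx; rewrite dvdz_primeM negb_or => /andP[? ?].
by rewrite nonresM // nonres_sqr addbF.
Qed.

Lemma Fp_root_of_minus1 n : (n.*2 %| l.-1)%N -> (0 < n)%N ->
  exists h : 'F_l, h ^+ n = -1.
Proof.
move=> /dvdnP[k kE] n0; have [g g0 [_ gP]] := Fp_generator l l_pr.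
have l1 := prime_gt1 l_pr.
exists (g ^+ k); rewrite -exprM.
have : (g ^+ (k * n)) ^+ 2 == 1.
  rewrite -exprM -mulnA muln2 -kE; apply/eqP/(mulfI g0).
  by rewrite -exprS prednK ?(ltnW l1) // mulr1 -[in RHS](expf_card g) (card_Fp l_pr).
rewrite sqrf_eq1 => /orP[/eqP/gP|/eqP //] /dvdn_leq.
by rewrite kE; nia.
Qed.

Lemma nonresN1_1mod4 : (l = 1 %[mod 4])%N -> nonres l (-1) = false.
Proof.
move=> l4; have [|//|h hE] := Fp_root_of_minus1 2; first by lia.
by rewrite nonresE; apply/negbTE; rewrite negb_and !negbK; apply/orP; right;
  apply/existsP; exists h; rewrite hE.
Qed.

Lemma nonresN1_3mod4 : (l = 3 %[mod 4])%N -> nonres l (-1) = true.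
Proof.
move=> l4; rewrite nonresE rmorphN1 oppr_eq0 oner_eq0 /=.
apply/existsP => [[y /eqP yE]].
have y0 : y != 0 by rewrite -sqrf_eq0 yE oppr_eq0 oner_eq0.
have : y ^+ l.-1 = 1.
  apply: (mulfI y0); rewrite -exprS prednK ?prime_gt0 // mulr1.
  by rewrite -[in RHS](expf_card y) (card_Fp l_pr).
have -> : l.-1 = (2 * (l %/ 4).*2.+1)%N by lia.
rewrite exprM yE -signr_odd /= odd_double /= expr1 => /eqP.
rewrite eq_sym -subr_eq0 opprK -[1 + 1]/(2%:R) -(dvdn_pcharf (pchar_Fp l_pr)).
by move/dvdn_leq; lia.
Qed.

(** For a primitive eighth root of unity h, the square of h + 1/h is 2. *)
Lemma nonres2_1mod8 : (l = 1 %[mod 8])%N -> nonres l 2 = false.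
Proof.
move=> l8; have [|//|h hE] := Fp_root_of_minus1 4; first by lia.
rewrite nonresE; apply/negbTE; rewrite negb_and !negbK; apply/orP; right.
have h0 : h != 0 by have := oner_neq0 'F_l; rewrite -oppr_eq0 -hE expf_eq0.
apply/existsP; exists (h + h^-1).
have E : h ^+ 2 + h^-1 ^+ 2 = 0.
  apply: (mulfI (expf_neq0 2 h0)); rewrite mulr0 mulrDr exprVn mulfV ?expf_neq0 //.
  by rewrite -exprD hE addNr.
rewrite sqrrD addrAC E add0r mulfV //.
Qed.
End Nonresidues.

(** * Reciprocity from Pell's equation *)

Local Notation chi l a := (nonres l (Posz a)).

Definition prime_part (S : pred nat) (ps : seq nat) : nat := \prod_(l <- ps | S l) l.

Lemma prime_part_cons S p ps :
  prime_part S (p :: ps) = if S p then (p * prime_part S ps)%N else prime_part S ps.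
Proof. exact: big_cons. Qed.

Lemma prime_part_nil S : prime_part S [::] = 1%N.
Proof. by rewrite /prime_part big_nil. Qed.

Lemma eq_prime_part S T ps : {in ps, S =1 T} -> prime_part S ps = prime_part T ps.
Proof.
by move=> ST; rewrite /prime_part big_seq_cond [RHS]big_seq_cond; apply: eq_bigl => l;
  case: (boolP (l \in ps)) => //= /ST.
Qed.

(** Divisors of a product of distinct primes are encoded by sets S of primes, which
    turns complementary divisors into complementary sets. *)
Lemma split_prime_product (ps : seq nat) (d1 d2 : nat) :
  uniq ps -> all prime ps -> (d1 * d2 = \prod_(l <- ps) l)%N ->
  exists S : pred nat, d1 = prime_part S ps /\ d2 = prime_part (predC S) ps.
Proof.
elim: ps d1 d2 => [|p ps IH] d1 d2 /=.
  rewrite big_nil => _ _ /eqP; rewrite muln_eq1 => /andP[/eqP -> /eqP ->].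
  by exists xpred0; rewrite !prime_part_nil.
rewrite big_cons => /andP[p_ps uniq_ps] /andP[p_pr ps_pr] dE.
have p0 := prime_gt0 p_pr.
have [i [e1 [e2 [d1E d2E eE]]]] : exists i e1 e2, [/\ d1 = ((if i then p else 1) * e1)%N,
    d2 = ((if ~~ i then p else 1) * e2)%N & (e1 * e2 = \prod_(l <- ps) l)%N].
  have : (p %| d1 * d2)%N by rewrite dE dvdn_mulr.
  rewrite Euclid_dvdM // => /orP[/dvdnP[k kE]|/dvdnP[k kE]].
    exists true, k, d2; rewrite /= mul1n kE mulnC; split=> //.
    by apply/eqP; rewrite -(eqn_pmul2l p0) -dE kE mulnA (mulnC p).
  exists false, d1, k; rewrite /= mul1n kE mulnC; split=> //.
  by apply/eqP; rewrite -(eqn_pmul2l p0) -dE kE; apply/eqP; ring.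
have [S [e1E e2E]] := IH _ _ uniq_ps ps_pr eE.
exists (fun l => if l == p then i else S l); rewrite !prime_part_cons /= eqxx d1E d2E e1E e2E.
have same l : l \in ps -> (if l == p then i else S l) = S l.
  by move=> l_ps; case: eqP => // lp; rewrite -lp l_ps in p_ps.
by case: (i) same => /= same; rewrite mul1n; split; try congr (_ * _)%N;
  apply: eq_prime_part => l /same /= ->.
Qed.

Lemma squarefreeM (p n : nat) : prime p -> ~~ (p %| n)%N -> squarefree n -> squarefree (p * n).
Proof.
move=> p_pr pn sqfn l l_pr; apply/negP; have [->|lp] := eqVneq l p.
  by rewrite expnS expn1 dvdn_pmul2l ?prime_gt0 // (negbTE pn).
rewrite Gauss_dvdr; first by apply/negP/sqfn.
by rewrite coprimeXl // prime_coprime // dvdn_prime2.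
Qed.

Lemma squarefree1 : squarefree 1.
Proof. by move=> l l_pr; rewrite dvdn1 expnS expn1; have := prime_gt1 l_pr; case: l {l_pr} => [|[]]. Qed.

Lemma squarefree_prime_product ps : uniq ps -> all prime ps ->
  squarefree (\prod_(l <- ps) l).
Proof.
elim: ps => [|p ps IH] /=; first by rewrite big_nil => _ _; apply: squarefree1.
move=> /andP[p_ps uniq_ps] /andP[p_pr ps_pr]; rewrite big_cons.
apply: squarefreeM => //; last exact: IH.
rewrite Euclid_dvd_prod // big_has; apply/hasPn => l l_ps /=.
by rewrite dvdn_prime2 // ?(allP ps_pr) //; apply: contraNneq p_ps => ->.
Qed.

Section AtPrime.
Variables (l : nat) (ps : seq nat).
Hypotheses (l_pr : prime l) (ps_pr : all prime ps).

Lemma ndvd_prime_part (S : pred nat) : ~~ S l -> ~~ (l %| prime_part S ps)%N.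
Proof.
move=> Sl; rewrite Euclid_dvd_prod //; rewrite big_has_cond; apply/hasPn => p p_ps /=.
rewrite dvdn_prime2 // ?(allP ps_pr) //.
by apply/andP => [[Sp /eqP lp]]; rewrite lp Sp in Sl.
Qed.

Lemma chi_prime_part (S : pred nat) : ~~ S l ->
  chi l (prime_part S ps) = \big[addb/false]_(p <- ps | S p) chi l p.
Proof.
move=> Sl; move: (ndvd_prime_part S Sl); rewrite /prime_part.
elim: ps => [|p qs IH]; first by rewrite !big_nil nonres1.
rewrite !big_cons; case: (S p) => //; rewrite Euclid_dvdM // negb_or => /andP[lp lqs].
by rewrite PoszM nonresM // IH.
Qed.

(** The prime l divides exactly one of the two coefficients. If it divides the second
    one, the first is e times a square modulo l; if it divides the first one, the
    opposite of the second is. In both cases only the primes on the other side of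
    l occur. *)
Lemma chi_represented (S : pred nat) (a b e : nat) : l \in ps -> ~~ (l %| e)%N ->
  (prime_part S ps * a ^ 2 = prime_part (predC S) ps * b ^ 2 + e)%N ->
  chi l e = (S l && nonres l (-1)) (+) \big[addb/false]_(p <- ps | S p != S l) chi l p.
Proof.
have dvd (T : pred nat) : l \in ps -> T l -> (l %| prime_part T ps)%N.
  by move=> l_ps Tl; rewrite /prime_part (big_rem l l_ps) /= Tl dvdn_mulr.
move=> l_ps le E; have {E} : (Posz (prime_part S ps) * Posz a ^+ 2 =
    Posz (prime_part (predC S) ps) * Posz b ^+ 2 + Posz e) by lia.
case: (boolP (S l)) => [Sl|nSl] E /=.
  have nSl : ~~ predC S l by rewrite /= Sl.
  rewrite (eq_bigl (predC S)) => [|p] /=; last by case: (S p).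
  rewrite -chi_prime_part // -nonresM //; last exact: ndvd_prime_part.
    apply/esym/(nonres_represented l l_pr _ (- Posz (prime_part S ps)) b a) => //.
      by rewrite mulN1r !mulNr E; ring.
    by rewrite rpredN; apply: dvd.
  by rewrite dvdzE abszN absz1 dvdn1 neq_ltn prime_gt1 ?orbT.
rewrite (eq_bigl S) => [|p] /=; last by case: (S p).
rewrite -chi_prime_part //.
by apply/esym/(nonres_represented l l_pr _ _ a b _ E) => //; apply: dvd.
Qed.
End AtPrime.

Lemma prime_product_gt1 (ps : seq nat) : all prime ps -> (0 < size ps)%N ->
  (1 < \prod_(l <- ps) l)%N.
Proof.
case: ps => //= p qs /andP[p_pr qs_pr] _.
rewrite big_cons (leq_trans (prime_gt1 p_pr)) // leq_pmulr //.
by rewrite big_seq prodn_cond_gt0 // => l /(allP qs_pr)/prime_gt0.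
Qed.

(** The descent for a product of distinct odd primes, as a system of linear equations
    over the field with two elements: one for each prime of the list. *)
Theorem pell_primes (ps : seq nat) : uniq ps -> all prime ps -> all odd ps ->
  (0 < size ps)%N ->
  exists (S : pred nat) (a b e : nat),
  [/\ (prime_part S ps * a ^ 2 = prime_part (predC S) ps * b ^ 2 + e)%N,
      e = 1%N \/ e = 2%N, ~~ has S ps -> e = 2%N &
      {in ps, forall l, chi l e = (S l && nonres l (-1)) (+)
         \big[addb/false]_(p <- ps | S p != S l) chi l p}].
Proof.
move=> uniq_ps ps_pr ps_odd ps_gt0.
have [|||d1 [d2 [a [b [e [dE E e12 d1e]]]]]] := pell_descent (\prod_(l <- ps) l).
- exact: squarefree_prime_product.
- exact: prime_product_gt1.
- elim: ps ps_odd {ps_gt0 uniq_ps ps_pr} => [|p qs IH] /=; first by rewrite big_nil.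
  by rewrite big_cons oddM => /andP[-> /IH].
have [S [d1E d2E]] := split_prime_product ps d1 d2 uniq_ps ps_pr dE.
subst d1 d2; exists S, a, b, e; split=> //.
  move=> noS; apply: d1e; rewrite /prime_part big_seq_cond big_pred0 // => l.
  by apply/andP => [[l_ps Sl]]; move/hasPn/(_ l l_ps): noS; rewrite Sl.
move=> l l_ps; have l_pr := allP ps_pr l l_ps; have l_odd := allP ps_odd l l_ps.
apply: chi_represented l_ps _ E => //.
have l_gt1 := prime_gt1 l_pr; case: e12 => ->; first by rewrite dvdn1 neq_ltn l_gt1 orbT.
by rewrite dvdn_prime2 //; apply: contraTneq l_odd => ->.
Qed.

Lemma modn_square8 (a : nat) : (a ^ 2 %% 8 \in [:: 0; 1; 4])%N.
Proof.
rewrite -modnXm; move: (a %% 8)%N (ltn_pmod a (isT : 0 < 8)%N).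
by do 8 case=> [//|].
Qed.

Lemma represented_mod8 (m n a b e : nat) :
  (m * a ^ 2 = n * b ^ 2 + e)%N ->
  exists A B, [/\ (A \in [:: 0; 1; 4])%N, (B \in [:: 0; 1; 4])%N &
   ((m %% 8) * A = (n %% 8) * B + e %[mod 8])%N].
Proof.
move=> E; exists (a ^ 2 %% 8)%N, (b ^ 2 %% 8)%N; rewrite !modn_square8; split=> //.
by rewrite -[in RHS]modnDml !modnMm [in RHS]modnDml E.
Qed.

Ltac residues8 E :=
  move: E => [A [B []]]; rewrite !inE => /or3P[] /eqP -> /or3P[] /eqP ->.

(** Modulo 4, d1 and d2 are equal and odd, so d1 a^2 - d2 b^2 is not 2. *)
Lemma pell_sign_1mod4 (d1 d2 a b e : nat) : (d1 * d2 = 1 %[mod 4])%N ->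
  (d1 * a ^ 2 = d2 * b ^ 2 + e)%N -> e = 1%N \/ e = 2%N -> e = 1%N.
Proof.
move=> dE /represented_mod8 E [] // e2; exfalso; rewrite e2 in E.
have {}dE : (d1 %% 8 %% 4 * (d2 %% 8 %% 4) = 1 %[mod 4])%N by rewrite !modn_dvdm // modnMm.
have := ltn_pmod d1 (isT : 0 < 8)%N; have := ltn_pmod d2 (isT : 0 < 8)%N.
move: (d1 %% 8)%N (d2 %% 8)%N dE E => x y dE E; residues8 E; 
by case: x dE => [|[|[|[|[|[|[|[|]]]]]]]] //; case: y => [|[|[|[|[|[|[|[|]]]]]]]].
Qed.

Ltac expand_primes :=
  rewrite ?prime_part_cons ?prime_part_nil ?big_cons ?big_nil /=.

Lemma odd_3mod4 (p : nat) : (p = 3 %[mod 4])%N -> odd p.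
Proof. by move=> p4; lia. Qed.

(** Applied to p q, which is 1 mod 4, the descent represents 1 by the form with
    coefficients p and -q, up to exchanging p and q: the splitting p q, 1 would make
    -1 a square modulo p. *)
Lemma reciprocity_3_3 (p q : nat) : prime p -> prime q -> p != q ->
  (p = 3 %[mod 4])%N -> (q = 3 %[mod 4])%N -> chi p q = ~~ chi q p.
Proof.
move=> p_pr q_pr pq p4 q4.
have [||||S [a [b [e [E e12 S_e chiE]]]]] := pell_primes [:: p; q].
- by rewrite /= inE pq.
- by rewrite /= p_pr q_pr.
- by rewrite /= !odd_3mod4.
- by [].
have e1 : e = 1%N.
  apply: pell_sign_1mod4 E e12.
  by expand_primes; case: (S p); case: (S q) => /=; rewrite ?muln1 ?mul1n -modnMm ?p4 ?q4.
move: (chiE p) (chiE q) S_e; rewrite !inE !eqxx orbT e1 => /(_ isT) + /(_ isT).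
expand_primes; rewrite !nonres1 // !nonresN1_3mod4 //.
by case: (S p); case: (S q) => //=; case: (chi p q); case: (chi q p) => //= _ _ /(_ isT).
Qed.

(** Applied to q, the descent represents 2 or -2 by x^2 - q y^2 with x and y odd; the
    sign determines both the residue of q modulo 8 and the symbol. *)
Lemma chi2_3mod4 (q : nat) : prime q -> (q = 3 %[mod 4])%N ->
  chi q 2 = (q %% 8 == 3)%N.
Proof.
move=> q_pr q4.
have [||||S [a [b [e [E e12 S_e chiE]]]]] := pell_primes [:: q].
- by [].
- by rewrite /= q_pr.
- by rewrite /= odd_3mod4.
- by [].
move: (chiE q) S_e E; rewrite !inE !eqxx => /(_ isT).
expand_primes; rewrite nonresN1_3mod4 //.
have q8 : (q %% 8 == 3)%N || (q %% 8 == 7)%N by lia.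
case: (S q) => /=; rewrite ?muln1.
  case: e12 => ->; first by rewrite nonres1.
  move=> -> _ /represented_mod8 E; case/orP: q8 => /eqP q8; rewrite q8 // in E *.
  by residues8 E.
move=> chi_e /(_ isT) e2; rewrite e2 in chi_e *; rewrite chi_e => /represented_mod8 E.
by case/orP: q8 => /eqP q8; rewrite q8 // in E *; residues8 E.
Qed.

(** Here s is 5 mod 8, as 2 is not a square modulo s. In the descent for q s, the
    splittings with coefficients 1 and q s would make 2 a square modulo s, or -1 a
    square modulo q. The other ones are compared modulo q, s and 8. *)
Lemma reciprocity_3_1 (q s : nat) : prime q -> prime s ->
  (q = 3 %[mod 4])%N -> (s = 1 %[mod 4])%N -> chi s 2 -> chi q s = chi s q.
Proof.
move=> q_pr s_pr q4 s4 s2.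
have s8 : (s %% 8 = 5)%N.
  have : (s %% 8 == 1)%N || (s %% 8 == 5)%N by lia.
  by case/orP => /eqP // s8; rewrite nonres2_1mod8 in s2.
have q8 : (q %% 8 == 3)%N || (q %% 8 == 7)%N by lia.
have [||||S [a [b [e [E e12 S_e chiE]]]]] := pell_primes [:: q; s].
- by rewrite /= inE andbT; apply/eqP => qs; rewrite qs s4 in q4.
- by rewrite /= q_pr s_pr.
- by rewrite /= odd_3mod4 // andbT; lia.
- by [].
move: (chiE q) (chiE s) S_e E; rewrite !inE !eqxx orbT => /(_ isT) + /(_ isT).
expand_primes; rewrite (nonresN1_3mod4 _ q_pr q4) (nonresN1_1mod4 _ s_pr s4).
case: (S q); case: (S s) => /=; rewrite ?muln1 ?addbF => Eq Es S_e;
  case: e12 => e12; rewrite e12 ?nonres1 // in Eq Es S_e *; rewrite ?s2 // in Es.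
- move=> /represented_mod8; rewrite s8 => E.
  by case/orP: q8 => /eqP q8; rewrite q8 in E; residues8 E.
- rewrite chi2_3mod4 // in Eq; rewrite -Es => /represented_mod8; rewrite s8 => E.
  by case/orP: q8 Eq => /eqP q8; rewrite q8 in E * => /=; case: (chi q s) => // _; residues8 E.
- by rewrite -Es -Eq.
- rewrite chi2_3mod4 // in Eq; rewrite -Es -Eq => /represented_mod8; rewrite s8 => E.
  by case/orP: q8 => /eqP q8; rewrite q8 in E *; residues8 E.
- by have := S_e isT.
Qed.

(** * The square classes forced by the Legendre symbols *)

(** Two vectors that are independent modulo (1, 1, 1) span, together with it, the whole
    space over the field with two elements. *)
Lemma span_mod_ones (Q : bool -> bool -> bool -> Prop) (j k t j' k' t' : bool) :
  (forall a b c a' b' c', Q a b c -> Q a' b' c' -> Q (a (+) a') (b (+) b') (c (+) c')) ->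
  Q true true true -> Q j k t -> Q j' k' t' ->
  ~~ ((j == k) && (k == t)) -> ~~ ((j' == k') && (k' == t')) ->
  ~~ ((j (+) j' == k (+) k') && (k (+) k' == t (+) t')) ->
  [/\ Q true false false, Q false true false & Q false false true].
Proof.
move=> Qx Q1 Q2 Q3.
have Q4 := Qx _ _ _ _ _ _ Q2 Q3.
have := (Qx _ _ _ _ _ _ Q1 Q2); have := (Qx _ _ _ _ _ _ Q1 Q3).
have := (Qx _ _ _ _ _ _ Q1 Q4); move: Q2 Q3 Q4.
by case: j; case: k; case: t => //; case: j'; case: k'; case: t'.
Qed.

Section SquareClasses.
(** P stands for a subgroup of the positive rationals modulo squares, given by its
    integers. *)
Variable P : nat -> Prop.
Hypothesis PM : forall m n, P m -> P n -> P (m * n)%N.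
Hypothesis P_sqr : forall m n, (0 < n)%N -> P (m * n ^ 2)%N -> P m.

Lemma subgroup_div m n : (0 < m)%N -> P m -> P (n * m)%N -> P n.
Proof.
move=> m0 Pm Pnm; apply: (P_sqr _ m m0).
by rewrite expnS expn1 mulnA; apply: PM.
Qed.

Lemma prime_part_gt0 S ps : all prime ps -> (0 < prime_part S ps)%N.
Proof.
move=> ps_pr; rewrite /prime_part big_seq_cond prodn_cond_gt0 // => l /andP[l_ps _].
by apply/prime_gt0/(allP ps_pr).
Qed.

(** The product of two squarefree integers is, up to the square of their common part,
    the integer supported by the symmetric difference. *)
Lemma subgroup_symdiff S T ps : all prime ps ->
  P (prime_part S ps) -> P (prime_part T ps) ->
  P (prime_part (fun l => S l (+) T l) ps).
Proof.
move=> ps_pr PS PT; apply: (P_sqr _ (prime_part (predI S T) ps)).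
  exact: prime_part_gt0.
rewrite (_ : (_ * _)%N = (prime_part S ps * prime_part T ps)%N); first exact: PM.
elim: ps {ps_pr PS PT} => [|p ps IH]; first by rewrite !prime_part_nil.
have {}IH := IH; have IHp := congr1 (muln p) IH; have IHpp := congr1 (muln (p ^ 2)%N) IH.
rewrite !prime_part_cons /=; case: (S p); case: (T p) => //=; rewrite ?expnMn;
  move: IHp IHpp; do ![set X := prime_part _ _]; clear; lia.
Qed.

Variables p q r s : nat.
Hypotheses (p_pr : prime p) (q_pr : prime q) (r_pr : prime r) (s_pr : prime s).
Hypotheses (p4 : (p = 3 %[mod 4])%N) (q4 : (q = 3 %[mod 4])%N)
  (r4 : (r = 3 %[mod 4])%N) (s4 : (s = 1 %[mod 4])%N).
Hypotheses (pq : p != q) (pr : p != r) (qr : q != r).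
Hypothesis P_D : forall D, D \in [:: p; q * r * s; p * q * r * s]%N -> P D.
Hypothesis P_pell : forall D, D \in [:: p; q * r * s; p * q * r * s]%N ->
  forall d1 d2 a b e, (d1 * d2 = D)%N -> (d1 * a ^ 2 = d2 * b ^ 2 + e)%N ->
  e = 1%N \/ e = 2%N -> P (e * d1)%N.
Hypotheses (s2 : chi s 2) (sp : ~~ chi s p).
Hypothesis not_both : chi s q || chi s r.
Hypothesis p_qr : chi p q (+) chi p r.
Hypothesis q_pr_or : (chi q p (+) chi q r) || (chi s q && chi s r).

Let s_neq l : (l = 3 %[mod 4])%N -> l != s.
Proof. by move=> l4; apply/eqP => ls; rewrite ls s4 in l4. Qed.

Let ps := [:: p; q; r; s].
Let uniq_ps : uniq ps.
Proof. by rewrite /= !inE !negb_or pq pr qr !s_neq. Qed.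
Let ps_pr : all prime ps.
Proof. by rewrite /= p_pr q_pr r_pr s_pr. Qed.
Let ps_odd : all odd ps.
Proof. by rewrite /= (odd_3mod4 p) ?(odd_3mod4 q) ?(odd_3mod4 r) //= andbT; clear -s4; lia. Qed.

Lemma prime_part_mul_predC S (qs : seq nat) :
  (prime_part S qs * prime_part (predC S) qs = \prod_(l <- qs) l)%N.
Proof. by rewrite /prime_part [RHS](bigID S). Qed.

(** The form x^2 - p y^2 represents 2 or -2. *)
Lemma subgroup_two : P 2.
Proof.
have [||||S [a [b [e [E e12 S_e chiE]]]]] := pell_primes [:: p].
- by [].
- by rewrite /= p_pr.
- by rewrite /= odd_3mod4.
- by [].
have DE : (prime_part S [:: p] * prime_part (predC S) [:: p] = p)%N.
  by rewrite prime_part_mul_predC big_cons big_nil muln1.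
have := P_pell p (mem_head _ _) _ _ a b e DE E e12.
move: (chiE p) S_e; rewrite !inE eqxx => /(_ isT).
expand_primes; rewrite nonresN1_3mod4 // muln1.
case: (S p) => /=; last by move=> _ /(_ isT) ->.
case: e12 => ->; first by rewrite nonres1.
move=> _ _; apply: subgroup_div; first exact: prime_gt0.
by apply: P_D; rewrite inE eqxx.
Qed.

(** Modulo p, which is in P, a divisor of p q r s is a vector (j, k, t) over the field
    with two elements, with (1, 1, 1) in P. The descents for q r s and p q r s give
    two more vectors of P; after reciprocity, their equations involve only five
    independent symbols, and a case analysis shows that the two vectors are
    independent modulo (1, 1, 1). In the descent for p q r s, the equation at s
    suffices when e = 2, as 2 is not a square modulo s. *)
Lemma subgroup_primes : [/\ P q, P r & P s].
Proof.
pose qs := [:: q; r; s].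
have qs_pr : all prime qs by rewrite /= q_pr r_pr s_pr.
have qs_odd : all odd qs by case/andP: ps_odd.
have uniq_qs : uniq qs by case/andP: uniq_ps.
have [qs_q qs_r qs_s] : [/\ q \in qs, r \in qs & s \in qs].
  by rewrite !inE !eqxx !orbT.
have [s_q s_r r_q] : [/\ s != q, s != r & r != q].
  by rewrite ![s == _]eq_sym !s_neq // eq_sym.
(* The vector (j, k, t) as a set of primes. *)
pose sel j k t : pred nat := fun l => if l == q then j else if l == r then k else t.
pose Q j k t := P (prime_part (sel j k t) qs).
have QS S : P (prime_part S qs) -> Q (S q) (S r) (S s).
  rewrite /Q (@eq_prime_part S (sel (S q) (S r) (S s)) qs) // => l.
  rewrite !inE /sel => /or3P[] /eqP ->; first by rewrite eqxx.
    by rewrite (negbTE r_q) eqxx.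
  by rewrite (negbTE s_q) (negbTE s_r).
have Qx a b c a' b' c' : Q a b c -> Q a' b' c' -> Q (a (+) a') (b (+) b') (c (+) c').
  move=> Q1 Q2; have := QS _ (subgroup_symdiff _ _ _ qs_pr Q1 Q2).
  by rewrite /sel !eqxx (negbTE r_q) (negbTE s_q) (negbTE s_r).
have Q1 : Q true true true.
  have : P (q * r * s)%N by apply: P_D; rewrite !inE eqxx orbT.
  by move=> H; apply: (QS xpredT); rewrite !prime_part_cons prime_part_nil muln1 mulnA.
have Q_out : Q true false false -> Q false true false -> Q false false true -> [/\ P q, P r & P s].
  by rewrite /Q !prime_part_cons !prime_part_nil /sel !eqxx (negbTE r_q) (negbTE s_q) (negbTE s_r) !muln1.
have [pqE prE qrE] : [/\ chi p q = ~~ chi q p, chi p r = ~~ chi r p & chi q r = ~~ chi r q].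
  by split; apply: reciprocity_3_3.
have [psE qsE rsE] : [/\ chi p s = false, chi q s = chi s q & chi r s = chi s r].
  by split; rewrite reciprocity_3_1 // (negbTE sp).
have n1 l : prime l -> (l = 3 %[mod 4])%N -> nonres l (-1) = true by exact: nonresN1_3mod4.
have [S [a [b [e [E e12 S_e chiE]]]]] := pell_primes qs uniq_qs qs_pr qs_odd isT.
have e1 : e = 1%N.
  apply: pell_sign_1mod4 E e12.
  rewrite prime_part_mul_predC !big_cons big_nil muln1 mulnA.
  by rewrite -modnMm -(modnMm q) q4 r4 s4.
(* The second vector, from q r s. *)
have QR2 : Q (S q) (S r) (S s).
  apply: QS; rewrite -[X in P X]mul1n -e1.
  apply: (P_pell (q * r * s)%N _ _ (prime_part (predC S) qs) a b) => //; first by rewrite !inE eqxx orbT.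
  by rewrite prime_part_mul_predC !big_cons big_nil muln1 mulnA.
move: (chiE q qs_q) (chiE r qs_r) (chiE s qs_s) S_e QR2; rewrite e1 {E e12 chiE}.
move=> Eq Er Es Se QR2.
have [T [a' [b' [e' [E e12 T_e chiE]]]]] := pell_primes ps uniq_ps ps_pr ps_odd isT.
(* The third vector, from p q r s, after removing the factors e and p. *)
have QR3 : Q (T q) (T r) (T s).
  have PT : P (e' * prime_part T ps)%N.
    apply: (P_pell (p * q * r * s)%N _ _ (prime_part (predC T) ps) a' b') => //; first by rewrite !inE eqxx !orbT.
    by rewrite prime_part_mul_predC !big_cons big_nil muln1 !mulnA.
  have {}PT : P (prime_part T ps).
    case: e12 PT => ->; first by rewrite mul1n.
    by rewrite mulnC; apply: subgroup_div => //; apply: subgroup_two.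
  apply: QS; move: PT; rewrite prime_part_cons; case: (T p) => //.
  rewrite mulnC; apply: subgroup_div; first exact: prime_gt0.
  by apply: P_D; rewrite inE eqxx.
have {E a' b' chiE} [Fp Fq Fr Fs] : [/\ chi p e' = (T p && nonres p (-1)) (+) \big[addb/false]_(l <- ps | T l != T p) chi p l,
   chi q e' = (T q && nonres q (-1)) (+) \big[addb/false]_(l <- ps | T l != T q) chi q l,
   chi r e' = (T r && nonres r (-1)) (+) \big[addb/false]_(l <- ps | T l != T r) chi r l &
   chi s e' = (T s && nonres s (-1)) (+) \big[addb/false]_(l <- ps | T l != T s) chi s l].
  by split; apply: chiE; rewrite !inE eqxx ?orbT.
suff [A B C] : [/\ ~~ ((S q == S r) && (S r == S s)), ~~ ((T q == T r) && (T r == T s)) &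
    ~~ ((S q (+) T q == S r (+) T r) && (S r (+) T r == S s (+) T s))].
  by have [] := span_mod_ones Q _ _ _ _ _ _ Qx Q1 QR2 QR3 A B C; apply: Q_out.
move: p_qr q_pr_or not_both.
move: Fp Fq Fr Fs T_e Eq Er Es Se; rewrite /ps /qs !big_cons !big_nil /= !eqxx /=.
rewrite (n1 p) // (n1 q) // (n1 r) // (nonresN1_1mod4 _ s_pr s4) !nonres1 //.
rewrite pqE prE qrE psE qsE rsE (negbTE sp).
move: (chi q p) (chi r p) (chi r q) (chi s q) (chi s r) => xqp xrp xrq xsq xsr.
move=> Fp Fq Fr Fs T_e Eq Er Es Se H1 H2 H3.
have {}Se : [|| S q, S r, S s | false] by apply: contraT => h; have := Se h.
move: Fp Fq Fr Fs T_e; case: e12 => ->; rewrite ?nonres1 // ?s2 => Fp Fq Fr Fs T_e.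
  have {}T_e : [|| T p, T q, T r, T s | false] by apply: contraT => h; have := T_e h.
  move: H1 H2 H3 Eq Er Es Se Fp Fq Fr Fs T_e; clear.
  move: (T p) (T q) (T r) (T s) (S q) (S r) (S s) => Tp Tq Tr Ts Sq Sr Ss.
  case: xsq; case: xsr => //; case: xqp; case: xrp => //; case: xrq => // _ _ _;
  case: Sq; case: Sr; case: Ss => //= _ _ _ _;
  by case: Tp; case: Tq; case: Tr; case: Ts.
move: H1 H2 H3 Eq Er Es Se Fs; clear.
move: (T p) (T q) (T r) (T s) (S q) (S r) (S s) => Tp Tq Tr Ts Sq Sr Ss.
case: xsq; case: xsr => //; case: xqp; case: xrp => //; case: xrq => // _ _ _;
case: Sq; case: Sr; case: Ss => //= _ _ _ _;
by case: Tp; case: Tq; case: Tr; case: Ts.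
Qed.
End SquareClasses.

(** * Maximal ideals *)

Section MaximalIdeals.
Local Open Scope classical_set_scope.
Variable R : comNzRingType.
Implicit Types (I J m : set R).

Lemma idealr_closedE I : idealr_closed (mem I) <->
  [/\ I 0, ~ I 1 & forall a u v, I u -> I v -> I (a * u + v)].
Proof.
split=> [[I0 I1 IL]|[I0 I1 IL]].
  split; [exact: set_mem I0|by move=> /mem_set; apply/negP|].
  by move=> a u v /mem_set Iu /mem_set Iv; apply/set_mem/IL.
split; [exact: mem_set|by apply/negP => /set_mem|].
by move=> a u v /set_mem Iu /set_mem Iv; apply/mem_set/IL.
Qed.

Section OneMaximal.
Variable m : set R.
Hypothesis m_max : maximal_ideal m.

Lemma maximal0 : m 0. Proof. by have [/idealr_closedE[]] := m_max. Qed.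

Lemma maximal1 : ~ m 1. Proof. by have [/idealr_closedE[]] := m_max. Qed.

Lemma maximalD u v : m u -> m v -> m (u + v).
Proof.
by move=> mu mv; have [/idealr_closedE[_ _ H] _] := m_max; rewrite -[u]mul1r; apply: H.
Qed.

Lemma maximalMl a u : m u -> m (a * u).
Proof.
move=> mu; have [/idealr_closedE[m0 _ H] _] := m_max.
by rewrite -[_ * _]addr0; apply: H.
Qed.

Lemma maximalMr a u : m u -> m (u * a).
Proof. by move=> mu; rewrite mulrC; apply: maximalMl. Qed.

Lemma maximalN u : m u -> m (- u).
Proof. by rewrite -mulN1r; apply: maximalMl. Qed.

Lemma maximalB u v : m u -> m v -> m (u - v).
Proof. by move=> mu mv; apply: maximalD => //; apply: maximalN. Qed.

Lemma maximal_sum (T : Type) (s : seq T) (Q : pred T) (F : T -> R) :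
  (forall i, Q i -> m (F i)) -> m (\sum_(i <- s | Q i) F i).
Proof. by move=> mF; elim/big_ind: _ => //; [exact: maximal0|exact: maximalD]. Qed.

Lemma maximal_inverse x : ~ m x -> exists a y, m y /\ 1 = a * x + y.
Proof.
move=> mx; apply: contrapT => noinv.
(* The ideal generated by m and x. *)
pose J := [set z | exists a y, m y /\ z = a * x + y].
have JE : J = m.
  have [_ maxm] := m_max; apply: maxm.
    apply/idealr_closedE; split.
    - by exists 0, 0; split; [exact: maximal0|rewrite mul0r addr0].
    - exact: noinv.
    - move=> a _ _ [b [y [my ->]]] [c [z [mz ->]]].
      exists (a * b + c), (a * y + z); split; last by ring.
      by apply: maximalD => //; apply: maximalMl.
  by move=> y my; exists 0, y; rewrite mul0r add0r.
apply: mx; rewrite -JE; exists 1, 0; split; [exact: maximal0|by rewrite mul1r addr0].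
Qed.

Lemma maximal_prime x y : m (x * y) -> m x \/ m y.
Proof.
move=> mxy; case: (pselect (m x)) => [|mx]; [by left|right].
have [a [z [mz E]]] := maximal_inverse x mx.
rewrite -[y]mul1r E mulrDl -mulrA.
by apply: maximalD; [apply: maximalMl|apply: maximalMr].
Qed.

Lemma maximal_primeX x n : m (x ^+ n) -> m x.
Proof.
elim: n => [|n IH]; first by rewrite expr0 => /maximal1.
by rewrite exprS => /maximal_prime[].
Qed.

Lemma maximal_prime_prod (T : finType) (F : T -> R) :
  m (\prod_i F i) -> exists i, m (F i).
Proof.
move=> mF; apply: contrapT => noi.
suff: ~ m (\prod_i F i) by [].
apply: (big_ind (fun x => ~ m x)) => [|x y mx my /maximal_prime[]//|i _ mi].
  exact maximal1.
by apply: noi; exists i.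
Qed.

Lemma maximal_int (l : nat) (z : int) : prime l -> m l%:R -> m z%:~R -> (l %| z)%Z.
Proof.
move=> l_pr ml mz; apply: contraT => lz; exfalso; apply maximal1.
have /eqP E : coprimez l z.
  by rewrite coprimezE prime_coprime -?dvdzE.
have [u [v uvE]] := Bezoutz l z.
rewrite -[1]/(1%:~R) -[X in X%:~R]E -uvE rmorphD !rmorphM /=.
by apply: maximalD; apply: maximalMl.
Qed.

End OneMaximal.

(** Maximality among proper ideals forbids strict inclusions. *)
Lemma maximal_separated m m' : maximal_ideal m -> maximal_ideal m' ->
  m <> m' -> exists x, m x /\ ~ m' x.
Proof.
move=> m_max m'_max neq; apply: contrapT => nox; apply: neq.
have [m_id maxm] := m_max; have [m'_id _] := m'_max.
by apply/esym/maxm => // x mx; apply: contrapT => m'x; apply: nox; exists x.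
Qed.

(** By the Chinese remainder theorem, a product of distinct maximal ideals is their
    intersection: if J is the intersection of the tail, then 1 = a b + y with b in J
    and y in m, and x = x (a b) + y x for x in both. *)
Lemma prod_maximalE (ms : seq (set R)) : uniq ms ->
  (forall m, m \in ms -> maximal_ideal m) ->
  \big[@ideal_mul R/setT]_(m <- ms) m = [set x | forall m, m \in ms -> m x].
Proof.
elim: ms => [|m ms IH] /=; first by rewrite big_nil => _ _; apply/seteqP; split.
move=> /andP[m_ms uniq_ms] ms_max; have m_max := ms_max m (mem_head _ _).
have ms_max' m' : m' \in ms -> maximal_ideal m'.
  by move=> ?; apply: ms_max; rewrite inE; apply/orP; right.
rewrite big_cons {}IH //; set J := [set x | _].
have J_mul a x : J x -> J (a * x).
  by move=> Jx m' m'_ms; apply: maximalMl (ms_max' _ m'_ms) _ _ (Jx _ m'_ms).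
apply/seteqP; split=> [_ [s sP ->] m'|x xP].
  move=> m'_in; rewrite big_seq; apply: (maximal_sum _ (ms_max _ m'_in)) => u /sP[mu Ju].
  move: m'_in (ms_max _ m'_in); rewrite inE => /orP[/eqP ->|m'_ms] m'_max.
    exact: maximalMr.
  by apply: maximalMl => //; apply: Ju.
have [b [Jb mb]] : exists b, J b /\ ~ m b.
  rewrite /J; have {x xP J J_mul uniq_ms ms_max} : forall m', m' \in ms -> exists x, m' x /\ ~ m x.
    move=> m' m'_ms; apply: maximal_separated => //; first exact: ms_max'.
    by move=> mE; rewrite -mE m'_ms in m_ms.
  elim: ms ms_max' {m_ms} => [|m' ms IH] ms_max' sep.
    by exists 1; split=> // /(maximal1 _ m_max).
  have [|m'' ?|b [Jb mb]] := IH.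
  - by move=> m'' ?; apply: ms_max'; rewrite inE; apply/orP; right.
  - by apply: sep; rewrite inE; apply/orP; right.
  have [x [m'x mx]] := sep m' (mem_head _ _).
  exists (x * b); split; last by move=> /(maximal_prime _ m_max)[].
  move=> m''; rewrite inE => /orP[/eqP ->|m''_ms].
    by apply: maximalMr => //; apply: ms_max'; rewrite mem_head.
  apply: maximalMl; last exact: Jb.
  by apply: ms_max'; rewrite inE; apply/orP; right.
have [a [y [my E]]] := maximal_inverse m m_max b mb.
have mx : m x by apply: xP; rewrite mem_head.
have Jx : J x by move=> m' m'_ms; apply: xP; rewrite inE; apply/orP; right.
exists [:: (x, a * b); (y, x)]; last by rewrite !big_cons big_nil /= -[LHS]mulr1 E; ring.
by move=> u; rewrite !inE => /orP[] /eqP -> /=; split=> //; apply: J_mul.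
Qed.

(** The finitely supported product is the unit ideal when A is infinite. *)
Lemma fsbig_maximal (A : set (set R)) : (forall m, A m -> maximal_ideal m) ->
  \big[@ideal_mul R/setT]_(m \in A) m = setT \/
  \big[@ideal_mul R/setT]_(m \in A) m = [set x | forall m, A m -> m x].
Proof.
move=> A_max.
have suppE : A `&` (fun m => m) @^-1` [set~ setT] = A.
  apply/seteqP; split=> [m []//|m Am]; split=> //= mT.
  by apply: (maximal1 _ (A_max _ Am)); rewrite mT.
case: (pselect (finite_set A)) => [finA|infA]; last first.
  by left; rewrite no_finite_support ?big_nil // suppE.
right; have memE : finite_support setT A (fun m => m) =i A.
  by move=> m; rewrite in_finite_support suppE.
rewrite prod_maximalE; [|exact: finite_support_uniq|].
  apply/seteqP; split=> x xP m; first by move=> Am; apply: xP; rewrite memE; apply: mem_set.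
  by rewrite memE => /set_mem; apply: xP.
by move=> m; rewrite memE => /set_mem/A_max.
Qed.

(** Adding 1 permutes the n cosets of m; comparing the sums of representatives before
    and after gives n = 0 modulo m. *)
Lemma norm_mem m n : maximal_ideal m -> ideal_norm_is m n -> m n%:R.
Proof.
move=> m_max; rewrite /ideal_norm_is card_eq_sym => /card_set_bijP[f [f_sub f_inj f_surj]].
pose coset x : set R := [set y | m (y - x)].
have coset_eq x y : coset x = coset y -> m (x - y).
  move=> E; have : coset x x by rewrite /coset /= subrr; apply: maximal0.
  by rewrite E.
have eq_coset x y : m (x - y) -> coset x = coset y.
  move=> mxy; apply/seteqP; rewrite /coset; split=> z /= mz.
    have -> : z - y = (z - x) + (x - y) by ring.
    exact: maximalD.
  have -> : z - x = (z - y) - (x - y) by ring.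
  exact: maximalB.
have /choice[r rE] : forall i : 'I_n, exists x, coset x = f i.
  by move=> i; have [x _ <-] := f_sub i (ltn_ord i); exists x.
have /choice[ix ixE] : forall x, exists i : 'I_n, f i = coset x.
  move=> x; have [i i_lt iE] : (f @` `I_n) (coset x) by apply: f_surj; exists x.
  by exists (Ordinal i_lt).
pose next i := ix (r i + 1).
have next_inj : injective next.
  move=> i j E; have : coset (r i + 1) = coset (r j + 1) by rewrite -!ixE -/(next i) E.
  move=> /coset_eq; rewrite opprD addrACA subrr addr0 => /eq_coset.
  by rewrite !rE => /f_inj E'; apply: val_inj; apply: E'; apply: mem_set; apply: ltn_ord.
have : m (\sum_i (r i + 1 - r (next i))).
  apply: maximal_sum => // i _; apply: coset_eq.
  by rewrite rE ixE.
have next_sum : \sum_i r (next i) = \sum_i r i by rewrite [RHS](reindex_inj next_inj).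
rewrite sumrB big_split /= next_sum.
by rewrite addrAC subrr add0r sumr_const card_ord.
Qed.

Lemma norm_prime_mem m (l f : nat) : maximal_ideal m ->
  ideal_norm_is m (l ^ f)%N -> m l%:R.
Proof. by move=> m_max /(norm_mem _ _ m_max); rewrite natrX; apply: maximal_primeX. Qed.

Section Automorphism.
Variables g h : {rmorphism R -> R}.
Hypotheses (gK : cancel g h) (hK : cancel h g).

Lemma maximal_preimage m : maximal_ideal m -> maximal_ideal (g @^-1` m).
Proof.
move=> m_max; split.
  apply/idealr_closedE; split=> [||a u v] /=; rewrite ?rmorph0 ?rmorph1.
  - exact: maximal0.
  - exact: (maximal1 _ m_max).
  - by rewrite rmorphD rmorphM => mu mv; apply: maximalD => //; apply: maximalMl.
move=> J /idealr_closedE[J0 J1 JL] mJ.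
have JE : h @^-1` J = m.
  have [_ maxm] := m_max; apply: maxm; last by move=> x mx; apply: mJ; rewrite /= hK.
  apply/idealr_closedE; split=> [||a u v] /=; rewrite ?rmorph0 ?rmorph1 //.
  by rewrite rmorphD rmorphM; apply: JL.
by rewrite -JE; apply/seteqP; split=> x /=; rewrite gK.
Qed.

Lemma norm_preimage m n : ideal_norm_is m n -> ideal_norm_is (g @^-1` m) n.
Proof.
rewrite /ideal_norm_is => mn; apply: card_eq_trans mn.
have -> : ideal_cosets (g @^-1` m) = (fun C => g @^-1` C) @` ideal_cosets m.
  apply/seteqP; split=> [_ [x _ <-]|_ [_ [x _ <-] <-]].
    by exists [set y | m (y - g x)]; [exists (g x)|apply/seteqP; split=> y /=; rewrite rmorphB].
  by exists (h x) => //; apply/seteqP; split=> y /=; rewrite rmorphB hK.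
apply: inj_card_eq => C D _ _ E; apply/seteqP; split=> x Cx.
  by have : (g @^-1` C) (h x) by [rewrite /= hK]; rewrite E /= hK.
by have : (g @^-1` D) (h x) by [rewrite /= hK]; rewrite -E /= hK.
Qed.
End Automorphism.
End MaximalIdeals.

(** * Galois action and descent by traces *)

Section GroupAction.
Local Open Scope classical_set_scope.
Variables (R : comNzRingType) (I : finType) (g h : I -> {rmorphism R -> R}) (i0 : I).
Hypotheses (gK : forall i, cancel (g i) (h i)) (hK : forall i, cancel (h i) (g i)).
Hypothesis g_i0 : forall x, g i0 x = x.
Hypothesis norm_int : forall x, exists z : int, \prod_i g i x = z%:~R.
Variable l : nat.
Hypothesis l_pr : prime l.

(** Otherwise the Chinese remainder theorem gives an x in m' that is 1 modulo all the
    conjugates of m. Its norm is an integer of m', hence a multiple of l, so it is in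
    m, and some conjugate of x is in m. *)
Lemma maximal_over_transitive (m m' : set R) :
  maximal_ideal m -> maximal_ideal m' -> m l%:R -> m' l%:R ->
  exists i, m' = g i @^-1` m.
Proof.
move=> m_max m'_max ml m'l; apply: contrapT => neq.
have /choice[y yP] : forall i, exists y, m (g i y) /\ m' (1 - y).
  move=> i; have gm_max := maximal_preimage _ _ _ (gK i) (hK i) _ m_max.
  have [|x [m'x gmx]] := maximal_separated _ _ _ m'_max gm_max.
    by move=> E; apply: neq; exists i.
  have [a [y [gmy E]]] := maximal_inverse _ _ gm_max _ gmx.
  exists y; split=> //; rewrite E addrK; exact: maximalMl.
have mY i : m (g i (\prod_j y j)).
  rewrite (bigD1 i) //= rmorphM; apply: maximalMr => //; exact: (yP i).1.
have m'Y : m' (1 - \prod_j y j).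
  apply: (big_ind (fun x => m' (1 - x))) => [|a b ma mb|i _]; last exact: (yP i).2.
    by rewrite subrr; apply: maximal0.
  have -> : 1 - a * b = (1 - a) + a * (1 - b) by ring.
  by apply: maximalD => //; apply: maximalMl.
have [z zE] := norm_int (1 - \prod_j y j).
have lz : (l %| z)%Z.
  apply: (maximal_int _ _ m'_max) => //; rewrite -zE (bigD1 i0) //= g_i0.
  exact: maximalMr.
have : m (\prod_i g i (1 - \prod_j y j)).
  rewrite zE; have /dvdzP[k ->] := lz; rewrite rmorphM /=; exact: maximalMl.
move=> /(maximal_prime_prod _ _ m_max)[i]; rewrite rmorphB rmorph1 => mi.
apply: (maximal1 _ _ m_max); rewrite -(subrK (g i (\prod_j y j)) 1).
exact: maximalD.
Qed.

(** By transitivity the maximal ideals of norm l^f are all those over l, or none. *)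
Lemma prod_maximal_principal (f : nat) (beta : R) : (0 < f)%N ->
  (forall m, maximal_ideal m -> m l%:R -> m beta) ->
  (forall x, (exists m : set R, maximal_ideal m /\ m l%:R) ->
     (forall m, maximal_ideal m -> m l%:R -> m x) -> exists y, x = beta * y) ->
  principal_ideal (\big[@ideal_mul R/setT]_(m \in
     [set m : set R | maximal_ideal m /\ ideal_norm_is m (l ^ f)%N]) m).
Proof.
move=> f0 beta_in beta_gen; set A := [set m | _].
have principalT : principal_ideal [set: R].
  by exists 1; apply/seteqP; split=> x //= _; exists x; rewrite ?mul1r.
have A_max m : A m -> maximal_ideal m by case.
have [->|->] := fsbig_maximal _ A A_max; first exact: principalT.
case: (pselect (exists m0, A m0)) => [[m0 [m0_max m0_norm]]|noA]; last first.
  rewrite (_ : [set x | _] = setT) //.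
  by apply/seteqP; split=> x //= _ m Am; case: noA; exists m.
have m0l := norm_prime_mem _ _ _ _ m0_max m0_norm.
have AE m : maximal_ideal m -> m l%:R -> A m.
  move=> m_max ml; have [i ->] := maximal_over_transitive _ _ m0_max m_max m0l ml.
  split; first exact: (maximal_preimage _ _ _ (gK i) (hK i)).
  exact: (norm_preimage _ _ _ (hK i)).
exists beta; apply/seteqP; split=> [x xP|_ [y _ <-] m [m_max m_norm]].
  have [||y ->] := beta_gen x; [by exists m0| |by exists y].
  by move=> m m_max ml; apply: xP; apply: AE.
by apply: maximalMr => //; apply: beta_in => //; apply: norm_prime_mem m_norm.
Qed.
End GroupAction.

Section Descent.
Local Open Scope classical_set_scope.
Variables (R : comNzRingType) (sigma tau : {rmorphism R -> R}).
Hypotheses (sigmaK : involutive sigma) (tauK : involutive tau).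
Hypothesis sigma_tau : forall x, sigma (tau x) = tau (sigma x).
Hypothesis fixed_int : forall x, sigma x = x -> tau x = x -> exists z : int, x = z%:~R.

Definition klein_aut (i : bool * bool) : {rmorphism R -> R} :=
  match i with
  | (true, true) => (sigma \o tau : {rmorphism R -> R})
  | (true, false) => sigma
  | (false, true) => tau
  | (false, false) => (idfun : {rmorphism R -> R})
  end.

Lemma klein_autK i : cancel (klein_aut i) (klein_aut i).
Proof.
move=> x; case: i => [[] []] //=; first by rewrite sigma_tau sigmaK tauK.
Qed.

Lemma klein_norm_int x : exists z : int, \prod_i klein_aut i x = z%:~R.
Proof.
rewrite (eq_bigr (fun i => klein_aut (i.1, i.2) x)); last by case.
rewrite -(pair_bigA _ (fun a b => klein_aut (a, b) x)) /= !big_bool /=.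
by apply: fixed_int; rewrite !rmorphM /= !sigma_tau ?sigmaK ?tauK; ring.
Qed.

Variable l : nat.
Hypothesis l_pr : prime l.

(** The intersection of the maximal ideals over l, that is the radical of (l). *)
Definition over_rad (x : R) : Prop := forall m, maximal_ideal m -> m l%:R -> m x.

Definition dvd_l (x : R) : Prop := exists y, x = l%:R * y.

Lemma dvd_lB x y : dvd_l x -> dvd_l y -> dvd_l (x - y).
Proof. by move=> [a ->] [b ->]; exists (a - b); rewrite mulrBr. Qed.

Lemma dvd_lMr x y : dvd_l x -> dvd_l (x * y).
Proof. by move=> [a ->]; exists (a * y); rewrite mulrA. Qed.

Lemma dvd_l_cancel (n : int) x : ~~ (l %| n)%Z -> dvd_l (x * n%:~R) -> dvd_l x.
Proof.
move=> ln [y E]; have /eqP cop : coprimez l n by rewrite coprimezE prime_coprime -?dvdzE.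
have [u [v uvE]] := Bezoutz l n.
have E1 : 1 = u%:~R * l%:R + v%:~R * n%:~R :> R.
  by have := congr1 (fun z : int => z%:~R : R) uvE; rewrite /= cop rmorphD !rmorphM => ->.
exists (u%:~R * x + v%:~R * y).
have -> : l%:R * (u%:~R * x + v%:~R * y) =
    u%:~R * l%:R * x + v%:~R * (l%:R * y) by ring.
by rewrite -E -[LHS]mul1r [X in X * _ = _]E1; ring.
Qed.

(** Cramer's rule: u (w - g w) is a combination of the traces of u and u w, and the
    square n of w - g w is the discriminant of w. *)
Lemma trace_descent (g : {rmorphism R -> R}) (w u : R) (n : int) :
  (w - g w) ^+ 2 = n%:~R -> ~~ (l %| n)%Z ->
  dvd_l (u + g u) -> dvd_l (u * w + g (u * w)) -> dvd_l u.
Proof.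
move=> wE ln tr0 tr1; apply: (dvd_l_cancel n) => //; rewrite -wE.
have -> : u * (w - g w) ^+ 2 =
    (u * w + g (u * w) - (u + g u) * g w) * (w - g w) by rewrite rmorphM; ring.
by apply: dvd_lMr; apply: dvd_lB => //; apply: dvd_lMr.
Qed.

Lemma over_radD x y : over_rad x -> over_rad y -> over_rad (x + y).
Proof. by move=> rx ry m m_max ml; apply: maximalD => //; [apply: rx|apply: ry]. Qed.

Lemma over_radMr x y : over_rad x -> over_rad (x * y).
Proof. by move=> rx m m_max ml; apply: maximalMr => //; apply: rx. Qed.

Lemma over_rad_aut (g : {rmorphism R -> R}) x : involutive g -> over_rad x -> over_rad (g x).
Proof.
move=> gK rx m m_max ml; apply: (rx (g @^-1` m)); first exact: (maximal_preimage _ _ _ gK gK).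
by rewrite /= rmorph_nat.
Qed.

Hypothesis over_ex : exists m : set R, maximal_ideal m /\ m l%:R.

(** A maximal ideal over l meets the rational integers in lZ. *)
Lemma over_rad_fixed u : over_rad u -> sigma u = u -> tau u = u -> dvd_l u.
Proof.
move=> ru su tu; have [z zE] := fixed_int _ su tu; have [m [m_max ml]] := over_ex.
have /dvdzP[k kE] : (l %| z)%Z.
  by apply: (maximal_int _ _ m_max) => //; rewrite -zE; apply: ru.
by exists k%:~R; rewrite zE kE rmorphM mulrC.
Qed.

(** The case of the quadratic subring fixed by tau, in which w has discriminant n. *)
Lemma over_rad_tau_fixed (w u : R) (n : int) : (w - sigma w) ^+ 2 = n%:~R ->
  ~~ (l %| n)%Z -> tau w = w -> over_rad u -> tau u = u -> dvd_l u.
Proof.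
move=> wE ln tw ru tu; apply: (trace_descent sigma w u n) => //.
  apply: over_rad_fixed; [by apply: over_radD => //; apply: over_rad_aut| |].
    by rewrite rmorphD sigmaK addrC.
  by rewrite rmorphD -sigma_tau tu.
apply: over_rad_fixed; rewrite ?rmorphD ?sigmaK -?sigma_tau.
- by apply: over_radD; [|apply: over_rad_aut => //]; apply: over_radMr.
- by rewrite addrC.
- by rewrite rmorphM tu tw.
Qed.

Section TauTower.
Variables (w : R) (n : int).
Hypotheses (wE : (w - sigma w) ^+ 2 = n%:~R) (ln : ~~ (l %| n)%Z) (tw : tau w = w).

Lemma over_rad_unramified (w' : R) (n' : int) x : (w' - tau w') ^+ 2 = n'%:~R ->
  ~~ (l %| n')%Z -> over_rad x -> dvd_l x.
Proof.
move=> wE' ln' rx.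
have step y : over_rad y -> dvd_l (y + tau y).
  move=> ry; apply: (over_rad_tau_fixed _ _ _ wE ln tw).
    by apply: over_radD => //; apply: over_rad_aut.
  by rewrite rmorphD tauK addrC.
by apply: (trace_descent tau w' x n') => //; apply: step => //; apply: over_radMr.
Qed.

(** The element x is a root of X^2 - (x + tau x) X + x tau x, whose coefficients are
    fixed by tau and in the radical, hence divisible by l. *)
Lemma over_rad_sqr x : over_rad x -> dvd_l (x ^+ 2).
Proof.
move=> rx; have -> : x ^+ 2 = (x + tau x) * x - x * tau x by ring.
apply: dvd_lB; first apply: dvd_lMr; apply: (over_rad_tau_fixed _ _ _ wE ln tw).
- by apply: over_radD => //; apply: over_rad_aut.
- by rewrite rmorphD tauK addrC.
- exact: over_radMr.
- by rewrite rmorphM tauK mulrC.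
Qed.
End TauTower.
End Descent.

(** * Biquadratic fields *)

(** The rationals are the fixed field of the Galois group. *)
Lemma gal_moves (L : splittingFieldType rat) (x : L) :
  x \notin 1%VS -> exists f : {rmorphism L -> L}, f x <> x.
Proof.
move=> x1; apply: contrapT => nof.
have gal1 : galois 1 {:L}.
  apply/and3P; split; [exact: subvf| |exact: normalFieldf].
  apply/separableP => y _; apply: pcharf0_separable.
  by move=> n; rewrite (fmorph_pchar (in_alg L)) pchar_num.
have /galois_fixedField fixE := gal1; move: x1; rewrite -fixE => /negP[].
apply/fixedFieldP => [|g _]; first exact: memvf.
by apply: contrapT => gx; apply: nof; exists (g : {rmorphism L -> L}).
Qed.

(** The same for an extension that is known to be a splitting field by a hypothesis
    only. *)
Lemma splitting_moves (K : fieldExtType rat) (x : K) : splitting_field_axiom K ->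
  x \notin 1%VS -> exists f : {rmorphism K -> K}, f x <> x.
Proof.
move=> axK; pose L : splittingFieldType rat :=
  HB.pack K (FieldExt_isSplittingField.Build rat K axK).
exact: (@gal_moves L x).
Qed.

Lemma ratr_alg (K : fieldExtType rat) (c : rat) : c%:A = ratr c :> K.
Proof. exact: (fmorph_eq_rat (in_alg K)). Qed.

Lemma quadratic_adjoin (K : fieldExtType rat) (E : {subfield K}) (b x : K) :
  b ^+ 2 \in E -> x \in <<E; b>>%VS ->
  exists u v, [/\ u \in E, v \in E & x = u + v * b].
Proof.
move=> bE /Fadjoin_polyP[f fE ->] {x}.
elim/poly_ind: f fE => [|f c IH] fcE.
  by exists 0, 0; rewrite horner0 mul0r addr0; split; rewrite ?mem0v.
have cE : c \in E by have := polyOverP fcE 0%N; rewrite coefD coefMX coefC add0r.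
have fE : f \is a polyOver E.
  apply/polyOverP => i; have := polyOverP fcE i.+1.
  by rewrite coefD coefMX coefC /= addr0.
have [u [v [uE vE fb]]] := IH fE.
exists (v * b ^+ 2 + c), u; split=> //; last by rewrite hornerD hornerMX hornerC fb; ring.
by apply: rpredD => //; apply: rpredM => //.
Qed.

Lemma biquadratic_coords (K : fieldExtType rat) (a b : K) (m n : nat) :
  a ^+ 2 = m%:R -> b ^+ 2 = n%:R -> <<1 & [:: a; b]>>%VS = fullv ->
  forall x : K, exists c0 c1 c2 c3 : rat,
    x = ratr c0 + ratr c1 * a + (ratr c2 + ratr c3 * a) * b.
Proof.
move=> aE bE genK x.
have : x \in <<<<1; a>>; b>>%VS by rewrite -adjoin_seq1 -adjoin_cons genK memvf.
have nat_in (E : {subfield K}) (k : nat) : k%:R \in E by rewrite rpred_nat.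
move=> /quadratic_adjoin[|u [v [uE vE ->]]]; first by rewrite bE rpred_nat.
have coords y : y \in <<1; a>>%VS -> exists c d : rat, y = ratr c + ratr d * a.
  move=> /quadratic_adjoin[|_ [_ [/vlineP[c ->] /vlineP[d ->] ->]]].
    by rewrite aE rpred_nat.
  by exists c, d; rewrite !ratr_alg.
have [c0 [c1 ->]] := coords _ uE; have [c2 [c3 ->]] := coords _ vE.
by exists c0, c1, c2, c3.
Qed.

Lemma biquadratic_splitting (K : fieldExtType rat) (a b : K) (m n : nat) :
  a ^+ 2 = m%:R -> b ^+ 2 = n%:R -> <<1 & [:: a; b]>>%VS = fullv ->
  splitting_field_axiom K.
Proof.
move=> aE bE genK; exists (('X^2 - m%:R%:P) * ('X^2 - n%:R%:P)).
  by rewrite rpredM // rpredB ?rpredX ?polyOverX ?polyOverC ?rpred_nat.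
exists [:: a; - a; b; - b].
  rewrite !big_cons big_nil mulr1 -aE -bE.
  rewrite (_ : _ * _ = ('X - a%:P) * (('X - (- a)%:P) * (('X - b%:P) * ('X - (- b)%:P)))) ?eqpxx //.
  by rewrite !rmorphN !rmorphXn /=; ring.
apply/eqP; rewrite eqEsubv subvf /= -genK; apply/Fadjoin_seqP; split.
  exact: subv_adjoin_seq.
by move=> x; rewrite !inE => /orP[] /eqP ->; apply: seqv_sub_adjoin; rewrite !inE eqxx ?orbT.
Qed.

(** A rational algebraic integer is an integer; this is transferred from the algebraic
    complex numbers through the polynomial. *)
Lemma integral_rational (K : fieldExtType rat) (c : rat) :
  integralOver (intr : int -> K) c%:A -> exists z : int, c = z%:~R.
Proof.
move=> [f f_monic f_root].
have : root (map_poly (intr : int -> rat) f) c.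
  move: f_root; rewrite -(eq_map_poly (fun z => rmorph_int (in_alg K) z)).
  by rewrite map_poly_comp fmorph_root.
move=> c_root.
have : (ratr c : algC) \in Num.int.
  apply: Cint_rat_Aint; first exact: Crat_rat.
  apply: (@root_monic_Aint (map_poly intr f)).
  - rewrite -(eq_map_poly (fun z => rmorph_int (ratr : {rmorphism rat -> algC}) z)).
    by rewrite map_poly_comp fmorph_root.
  - exact: monic_map.
  - by apply/polyOverP => i; rewrite coef_map /= intr_int.
move=> /intrP[z zE]; exists z; apply: (fmorph_inj (ratr : {rmorphism rat -> algC})).
by rewrite /= zE rmorph_int.
Qed.

Lemma rational_sqrt (K : fieldExtType rat) (a : K) (n : nat) :
  a ^+ 2 = n%:R -> a \in 1%VS -> exists z : int, z ^+ 2 = n%:Z.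
Proof.
move=> aE /vlineP[c cE].
have [z zE] : exists z : int, c = z%:~R.
  apply: (integral_rational K); exists ('X^2 - (n%:Z)%:P); first by rewrite monicXnsubC.
  by rewrite /root rmorphB rmorphXn /= map_polyX map_polyC /= !hornerE /= -cE aE subrr.
exists z; apply: (intr_inj (R := rat)); rewrite rmorphXn /= -zE -pmulrn.
by apply: (fmorph_inj (in_alg K)); rewrite rmorphXn rmorph_nat /= -cE aE.
Qed.

Section KleinGroup.
Variables (K : fieldExtType rat) (a b : K) (m n : nat).
Hypotheses (aE : a ^+ 2 = m%:R) (bE : b ^+ 2 = n%:R).
Hypothesis genK : <<1 & [:: a; b]>>%VS = fullv.
Hypotheses (a_irr : a \notin 1%VS) (b_irr : b \notin 1%VS) (ab_irr : a * b \notin 1%VS).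

Lemma sign_image (f : {rmorphism K -> K}) (x : K) (k : nat) :
  x ^+ 2 = k%:R -> f x = x \/ f x = - x.
Proof.
move=> xE; have /eqP := congr1 f xE; rewrite rmorphXn rmorph_nat -xE eqf_sqr.
by case/orP => /eqP ->; [left|right].
Qed.

(** Each of a, b, ab is moved by some automorphism, and automorphisms act on (a, b) by
    signs. A subgroup of the group of pairs of signs on which none of the three
    nontrivial characters is trivial is the whole group. *)
Lemma conjugations_exist : exists sigma tau : {rmorphism K -> K},
  [/\ sigma a = a, sigma b = - b, tau a = - a & tau b = b].
Proof.
have splitK := biquadratic_splitting _ _ _ _ _ aE bE genK.
have [f1 f1a] := splitting_moves _ _ splitK a_irr.
have [f2 f2b] := splitting_moves _ _ splitK b_irr.
have [f3 f3ab] := splitting_moves _ _ splitK ab_irr.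
have {}f1a : f1 a = - a by have [] := sign_image f1 _ _ aE.
have {}f2b : f2 b = - b by have [] := sign_image f2 _ _ bE.
have compE (f g : {rmorphism K -> K}) x : (f \o g : {rmorphism K -> K}) x = f (g x) by [].
have tauP : exists tau : {rmorphism K -> K}, tau a = - a /\ tau b = b.
  have [f1b|f1b] := sign_image f1 _ _ bE; first by exists f1.
  have [f2a|f2a] := sign_image f2 _ _ aE.
    by exists (f1 \o f2 : {rmorphism K -> K}); rewrite !compE f2a f2b rmorphN f1a f1b opprK.
  have [f3a|f3a] := sign_image f3 _ _ aE; have [f3b|f3b] := sign_image f3 _ _ bE.
  - by case: f3ab; rewrite rmorphM f3a f3b.
  - exists (f1 \o f3 : {rmorphism K -> K}); rewrite !compE f3a f3b rmorphN f1a f1b opprK //.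
  - by exists f3.
  - by case: f3ab; rewrite rmorphM f3a f3b mulrNN.
have [tau [ta tb]] := tauP.
have [f2a|f2a] := sign_image f2 _ _ aE; first by exists f2, tau.
by exists (f2 \o tau : {rmorphism K -> K}), tau; rewrite !compE ta tb rmorphN f2a f2b opprK.
Qed.

Lemma morphism_ext (f g : {rmorphism K -> K}) :
  f a = g a -> f b = g b -> f =1 g.
Proof.
move=> fa fb x; have [c0 [c1 [c2 [c3 ->]]]] := biquadratic_coords _ _ _ _ _ aE bE genK x.
by rewrite !(rmorphD, fmorph_rat, rmorphM) fa fb.
Qed.

Lemma conjugations_klein (sigma tau : {rmorphism K -> K}) :
  sigma a = a -> sigma b = - b -> tau a = - a -> tau b = b ->
  [/\ involutive sigma, involutive tau, forall x, sigma (tau x) = tau (sigma x) &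
    forall x, sigma x = x -> tau x = x -> exists c : rat, x = ratr c].
Proof.
move=> sa sb ta tb; split.
- by apply: (morphism_ext (sigma \o sigma : {rmorphism K -> K}) (idfun : {rmorphism K -> K}));
    rewrite /= ?sa ?sb ?rmorphN ?sb ?opprK.
- by apply: (morphism_ext (tau \o tau : {rmorphism K -> K}) (idfun : {rmorphism K -> K}));
    rewrite /= ?ta ?tb ?rmorphN ?ta ?opprK.
- by apply: (morphism_ext (sigma \o tau : {rmorphism K -> K}) (tau \o sigma : {rmorphism K -> K}));
    rewrite /= ?sa ?sb ?ta ?tb ?rmorphN ?sa ?sb ?ta ?tb.
move=> x; have [c0 [c1 [c2 [c3 ->]]]] := biquadratic_coords _ _ _ _ _ aE bE genK x.
have half0 (y : K) : - y = y -> y = 0.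
  move=> /eqP; rewrite -subr_eq0 -opprD oppr_eq0 -mulr2n -mulr_natr mulf_eq0 => /orP[/eqP //|].
  by rewrite (_ : 2%:R = (2 : rat)%:A) ?scaler_eq0 ?oner_eq0 // scaler_nat.
move=> sx.
have -> : (ratr c2 + ratr c3 * a) * b = 0.
  apply: half0; apply: (addrI (ratr c0 + ratr c1 * a)); rewrite -[RHS]sx.
  by rewrite !(rmorphD, fmorph_rat, rmorphM) sa sb mulrN.
rewrite addr0 => tx; have -> : ratr c1 * a = 0.
  apply: half0; apply: (addrI (ratr c0)); rewrite -[RHS]tx.
  by rewrite !(rmorphD, fmorph_rat, rmorphM) ta mulrN.
by exists c0; rewrite addr0.
Qed.
End KleinGroup.

Section IntegerAutomorphism.
Variables (K : fieldExtType rat) (f : {rmorphism K -> K}).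

Lemma integer_image (x : ringOfIntegers K) : f (val x) \in @integer_pred K.
Proof.
apply/integer_predP; have /integer_predP[u u_monic u_root] := valP x.
exists u => //; rewrite -(eq_map_poly (fun z => rmorph_int f z)) map_poly_comp.
exact: rmorph_root.
Qed.

Definition integer_aut (x : ringOfIntegers K) : ringOfIntegers K :=
  RingOfIntegers (integer_image x).

Lemma integer_aut_zmod_morphism : zmod_morphism integer_aut.
Proof. by move=> x y; apply: val_inj; rewrite /= rmorphB. Qed.

Lemma integer_aut_monoid_morphism : monoid_morphism integer_aut.
Proof. by split=> [|x y]; apply: val_inj; rewrite /= ?rmorph1 ?rmorphM. Qed.

HB.instance Definition _ := GRing.isZmodMorphism.Build _ _ integer_aut
  integer_aut_zmod_morphism.
HB.instance Definition _ := GRing.isMonoidMorphism.Build _ _ integer_aut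
  integer_aut_monoid_morphism.
End IntegerAutomorphism.

(** * Integers that are squares up to a unit *)

Section AssociatedSquares.
Variable K : fieldExtType rat.
Local Notation O := (ringOfIntegers K).

(** The ring of integers is integrally closed. *)
Lemma integer_sqrt (x : K) : x ^+ 2 \in @integer_pred K -> x \in @integer_pred K.
Proof.
move=> /integer_predP x2; apply/integer_predP.
apply: (integral_root_monic (p := 'X^2 - (x ^+ 2)%:P)); first by rewrite monicXnsubC.
  by rewrite /root !hornerE subrr.
apply/integral_poly => i; rewrite coefB coefXn coefC.
apply: integral_sub; first exact: integral_nat.
by case: eqP => _ //; apply: integral0.
Qed.

Definition assoc_square (n : nat) : Prop :=
  exists beta u v : O, beta ^+ 2 = n%:R * u /\ u * v = 1.

Lemma assoc_squareM m n : assoc_square m -> assoc_square n -> assoc_square (m * n).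
Proof.
move=> [x [u [v [xE uv]]]] [y [u' [v' [yE uv']]]].
exists (x * y), (u * u'), (v * v'); split; first by rewrite exprMn xE yE natrM; ring.
by rewrite mulrACA uv uv' mulr1.
Qed.

Lemma natr_neq0 n : (0 < n)%N -> n%:R != 0 :> K.
Proof.
move=> n0; rewrite -(rmorph_nat (in_alg K)) fmorph_eq0 pnatr_eq0; lia.
Qed.

Lemma assoc_square_cancel m n : (0 < n)%N -> assoc_square (m * n ^ 2) -> assoc_square m.
Proof.
move=> n0 [x [u [v [xE uv]]]]; have nK := natr_neq0 n n0.
have yE : (val x / n%:R) ^+ 2 = val (m%:R * u).
  have := congr1 val xE; rewrite rmorphXn !rmorphM !rmorph_nat /= => xE'.
  by rewrite expr_div_n xE'; field.
have yO : val x / n%:R \in @integer_pred K by apply: integer_sqrt; rewrite yE (valP (m%:R * u)).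
by exists (RingOfIntegers yO), u, v; split=> //; apply: val_inj; rewrite rmorphXn /= yE.
Qed.

Variables (c : O) (D : nat).
Hypothesis cE : c ^+ 2 = D%:R.

Lemma assoc_square_sqrt : assoc_square D.
Proof. by exists c, 1, 1; rewrite !mulr1. Qed.

(** The square of d1 a + b c is d1 (d1 a^2 + d2 b^2 + 2 a b c). With t = d2 b^2 and
    w = a b c, for which w^2 = (t + e) t, the last factor is 2t + 1 + 2w if e = 1 and
    2 (t + 1 + w) if e = 2; the conjugates 2t + 1 - 2w and t + 1 - w are inverses of
    2t + 1 + 2w and t + 1 + w. *)
Lemma assoc_square_represented (d1 d2 a b e : nat) : (d1 * d2 = D)%N ->
  (d1 * a ^ 2 = d2 * b ^ 2 + e)%N -> e = 1%N \/ e = 2%N -> assoc_square (e * d1).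
Proof.
move=> dE E e12; have c2E : c ^+ 2 = d1%:R * d2%:R by rewrite cE -dE natrM.
have {}E : d1%:R * a%:R ^+ 2 = d2%:R * b%:R ^+ 2 + e%:R :> O.
  by have := congr1 (fun k => k%:R : O) E; rewrite !(natrM, natrD, natrX).
rewrite /assoc_square natrM.
move: (d1%:R : O) (d2%:R : O) (a%:R : O) (b%:R : O) c2E E => x y A B c2E E.
have betaE : (x * A + B * c) ^+ 2 = x * (x * A ^+ 2 + y * B ^+ 2 + A * B * c *+ 2).
  have -> : (x * A + B * c) ^+ 2 =
    x ^+ 2 * A ^+ 2 + x * A * B * c *+ 2 + B ^+ 2 * c ^+ 2 by ring.
  by rewrite c2E; ring.
have normE : (A * B * c) ^+ 2 = (x * A ^+ 2) * (y * B ^+ 2).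
  by rewrite !exprMn c2E; ring.
move: betaE normE; rewrite E; set t := y * B ^+ 2; set w := A * B * c => betaE normE.
exists (x * A + B * c); case: e12 betaE normE => -> betaE normE.
  exists (t *+ 2 + 1 + w *+ 2), (t *+ 2 + 1 - w *+ 2); split; first by rewrite betaE; ring.
  have -> : (t *+ 2 + 1 + w *+ 2) * (t *+ 2 + 1 - w *+ 2) =
    (t *+ 2 + 1) ^+ 2 - w ^+ 2 *+ 4 by ring.
  by rewrite normE; ring.
exists (t + 1 + w), (t + 1 - w); split; first by rewrite betaE; ring.
have -> : (t + 1 + w) * (t + 1 - w) = (t + 1) ^+ 2 - w ^+ 2 by ring.
by rewrite normE; ring.
Qed.
End AssociatedSquares.

(** * Ostrowski ideals of biquadratic fields *)

Section RamifiedGenerator.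
Variable K : fieldExtType rat.
Local Notation O := (ringOfIntegers K).

(** The quotient x / beta is integral because its square is. *)
Lemma assoc_square_dvd (l : nat) (beta u v x : O) : (0 < l)%N ->
  beta ^+ 2 = l%:R * u -> u * v = 1 -> dvd_l O l (x ^+ 2) -> exists y, x = beta * y.
Proof.
move=> l0 betaE uv [y xE]; have lK := natr_neq0 K l l0.
have uvK : val u * val v = 1 by have := congr1 val uv; rewrite rmorphM rmorph1.
have betaK : val beta ^+ 2 = l%:R * val u.
  by have := congr1 val betaE; rewrite rmorphXn !rmorphM !rmorph_nat.
have xK : val x ^+ 2 = l%:R * val y.
  by have := congr1 val xE; rewrite rmorphXn !rmorphM !rmorph_nat.
have u0 : val u != 0 by apply: contraTneq (oner_neq0 K) => u0; rewrite -uvK u0 mul0r eqxx.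
have beta0 : val beta != 0 by rewrite -sqrf_eq0 betaK mulf_neq0.
have zE : (val x / val beta) ^+ 2 = val (y * v).
  have vE : val v = (val u)^-1 by apply: (mulfI u0); rewrite uvK mulfV.
  by rewrite rmorphM /= vE expr_div_n xK betaK -mulf_div divff // mul1r.
have zO : val x / val beta \in @integer_pred K by apply: integer_sqrt; rewrite zE (valP (y * v)).
by exists (RingOfIntegers zO); apply: val_inj; rewrite rmorphM /= mulrC divfK.
Qed.
End RamifiedGenerator.

Section Biquadratic.
Variables (K : fieldExtType rat) (a b : K) (m n : nat).
Hypotheses (aE : a ^+ 2 = m%:R) (bE : b ^+ 2 = n%:R).
Hypothesis genK : <<1 & [:: a; b]>>%VS = fullv.
Hypotheses (a_irr : a \notin 1%VS) (b_irr : b \notin 1%VS) (ab_irr : a * b \notin 1%VS).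
Hypotheses (mn : coprime m n) (n4 : (n = 1 %[mod 4])%N).
Hypothesis ram : forall l, prime l -> (l %| 2 * m * n)%N -> assoc_square K l.
Local Notation O := (ringOfIntegers K).

(** Every prime l is unramified in a step of one of the towers over the fixed fields of
    sigma and tau: the discriminants of a, b and (1 + b) / 2 are 4 m, 4 n and n, and l
    divides at most one of m and n. *)
Theorem biquadratic_polya : polya_field K.
Proof.
have [sigma [tau [sa sb ta tb]]] := conjugations_exist K a b m n aE bE genK a_irr b_irr ab_irr.
have [sigmaK tauK sigma_tau fixed] := conjugations_klein K a b m n aE bE genK _ _ sa sb ta tb.
pose S : {rmorphism O -> O} := integer_aut K sigma.
pose T : {rmorphism O -> O} := integer_aut K tau.
have SK : involutive S by move=> x; apply: val_inj; rewrite /= sigmaK.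
have TK : involutive T by move=> x; apply: val_inj; rewrite /= tauK.
have ST x : S (T x) = T (S x) by apply: val_inj; rewrite /= sigma_tau.
have fixO (x : O) : S x = x -> T x = x -> exists z : int, x = z%:~R.
  move=> /(congr1 val)/= Sx /(congr1 val)/= Tx; have [c cE] := fixed _ Sx Tx.
  rewrite -ratr_alg in cE.
  have [|z zE] := integral_rational K c; first by rewrite -cE; apply/integer_predP/(valP x).
  by exists z; apply: val_inj; rewrite rmorph_int /= cE zE scaler_int.
have sqrtO (x : K) (k : nat) : x ^+ 2 = k%:R -> x \in @integer_pred K.
  by move=> xE; apply: integer_sqrt; rewrite xE rpred_nat.
have two0 : 2%:R != 0 :> K by apply: natr_neq0.
have four0 : 4%:R != 0 :> K by apply: natr_neq0.
pose aO := RingOfIntegers (sqrtO _ _ aE); pose bO := RingOfIntegers (sqrtO _ _ bE).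
(* A root of X^2 - X - (n - 1) / 4. *)
have half_int : (1 + b) / 2%:R \in @integer_pred K.
  apply/integer_predP; pose k := (n %/ 4)%N.
  have nE : n%:R = 1 + 4 * k%:R :> K.
    have nE : n = (1 + 4 * k)%N by rewrite /k; clear -n4; lia.
    by rewrite {1}nE natrD natrM.
  apply: (integral_root_monic (p := 'X^2 - ('X + (k%:R)%:P))).
  - by rewrite monicE lead_coefDl ?lead_coefXn // size_polyN size_XaddC size_polyXn.
  - rewrite /root !hornerE; apply/eqP.
    have -> : (1 + b) / 2 * ((1 + b) / 2) - ((1 + b) / 2 + k%:R) =
      (b ^+ 2 - (1 + 4 * k%:R)) / 4 by field; rewrite two0 four0.
    by rewrite bE nE subrr mul0r.
  - apply/integral_poly => i; rewrite coefB coefD coefXn coefX coefC.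
    apply: integral_sub; first exact: integral_nat.
    apply: integral_add; first exact: integral_nat.
    by case: eqP => _; [apply: integral_nat|apply: integral0].
pose wO := RingOfIntegers half_int.
have waE : (aO - T aO) ^+ 2 = (4 * m)%:Z%:~R.
  apply: val_inj; rewrite -pmulrn rmorphXn rmorphB rmorph_nat /= ta opprK.
  by rewrite natrM -aE; ring.
have wbE : (bO - S bO) ^+ 2 = (4 * n)%:Z%:~R.
  apply: val_inj; rewrite -pmulrn rmorphXn rmorphB rmorph_nat /= sb opprK.
  by rewrite natrM -bE; ring.
have whE : (wO - S wO) ^+ 2 = n%:Z%:~R.
  apply: val_inj; rewrite -pmulrn rmorphXn rmorphB rmorph_nat /= -bE; congr (_ ^+ 2).
  rewrite rmorphM rmorphD fmorphV rmorph1 rmorph_nat sb; field; exact: two0.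
have Sa : S aO = aO by apply: val_inj.
have Tb : T bO = bO by apply: val_inj.
have Tw : T wO = wO by apply: val_inj; rewrite /= rmorphM rmorphD fmorphV rmorph1 rmorph_nat tb.
move=> l f l_pr f0.
have criterion beta := prod_maximal_principal O _ (klein_aut O S T) (klein_aut O S T) (false, false)
  (klein_autK O S T SK TK ST) (klein_autK O S T SK TK ST) (fun=> erefl)
  (klein_norm_int O S T SK TK ST fixO) l l_pr f beta f0.
have TS x : T (S x) = S (T x) by [].
have fixO' (x : O) : T x = x -> S x = x -> exists z : int, x = z%:~R by move=> Tx Sx; apply: fixO.
case: (boolP (l %| 2 * m * n)%N) => [l_ram|l_unram]; last first.
  apply: (criterion l%:R) => // x ex_l x_rad.
  have [l2 lm ln] : [/\ ~~ (l %| 2)%N, ~~ (l %| m)%N & ~~ (l %| n)%N].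
    by move: l_unram; rewrite !Euclid_dvdM // !negb_or => /andP[/andP[-> ->] ->].
  have l4 k : ~~ (l %| k)%N -> ~~ (l %| (4 * k)%:Z)%Z.
    by move=> lk; rewrite dvdzE /= Euclid_dvdM // negb_or lk (Euclid_dvdM 2 2) // (negbTE l2).
  exact: (over_rad_unramified O S T SK TK ST fixO l l_pr ex_l bO _ wbE (l4 _ ln) Tb _ _ _ waE (l4 _ lm)).
have [beta [u [v [betaE uv]]]] := ram l l_pr l_ram.
apply: (criterion beta) => [M M_max Ml|x ex_l x_rad].
  apply: (maximal_primeX _ _ M_max _ 2); rewrite betaE; exact: maximalMr.
apply: (assoc_square_dvd K l beta u v x (prime_gt0 l_pr)) => //.
have even_odd : l != 2%N -> ~~ (l %| 2)%N by move=> l2; rewrite dvdn_prime2.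
have l4 k : l != 2%N -> ~~ (l %| k)%N -> ~~ (l %| (4 * k)%:Z)%Z.
  by move=> /even_odd l2 lk; rewrite dvdzE /= Euclid_dvdM // negb_or lk (Euclid_dvdM 2 2) // (negbTE l2).
(* The step of the tower above the rationals must be unramified at l; the other may
   ramify. *)
have [l2|l2] := eqVneq l 2%N.
  apply: (over_rad_sqr O S T SK TK ST fixO l l_pr ex_l wO n whE _ Tw) => //.
  by rewrite dvdzE /= l2; clear -n4; lia.
case: (boolP (l %| n)%N) => [ln|ln].
  have lm : ~~ (l %| m)%N.
    apply/negP => lm; have : (l %| gcdn m n)%N by rewrite dvdn_gcd lm.
    by rewrite (eqP mn) dvdn1 => /eqP l1; rewrite l1 in l_pr.
  exact: (over_rad_sqr O T S TK SK TS fixO' l l_pr ex_l aO _ waE (l4 _ l2 lm) Sa).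
exact: (over_rad_sqr O S T SK TK ST fixO l l_pr ex_l bO _ wbE (l4 _ l2 ln) Tb).
Qed.
End Biquadratic.

(** * The fields of the theorem *)

Lemma legendre_nonres (l : nat) (a : int) : legendre a l = -1 -> nonres l a.
Proof. by move=> E; rewrite /nonres E. Qed.

Lemma legendre_not_nonres (l : nat) (a : int) : ~~ (l %| a)%Z -> ~~ nonres l a -> legendre a l = 1.
Proof.
by rewrite /nonres /legendre => /negbTE ->; case: ifP.
Qed.

(** A nonzero symbol excludes that l is one of the two primes. *)
Lemma legendre_mul_nonres (l x y : nat) : prime l -> prime x -> prime y ->
  legendre (x * y)%N%:Z l = -1 -> [/\ l != x, l != y & chi l x (+) chi l y].
Proof.
move=> l_pr x_pr y_pr E.
have lxy : ~~ (l %| x * y)%N.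
  apply/negP => lxy; move: E; rewrite /legendre.
  by have -> : (l %| (x * y)%N%:Z)%Z by [].
move: (lxy); rewrite Euclid_dvdM // negb_or => /andP[lx ly].
split; [by apply: contraNneq lx => ->|by apply: contraNneq ly => ->|].
by rewrite -nonresM //; apply: legendre_nonres.
Qed.

Section Main.
Variables (p q r s : nat).
Hypotheses (p_prime : prime p) (q_prime : prime q) (r_prime : prime r) (s_prime : prime s).
Hypotheses (p4 : (p = 3 %[mod 4])%N) (q4 : (q = 3 %[mod 4])%N)
  (r4 : (r = 3 %[mod 4])%N) (s4 : (s = 1 %[mod 4])%N).
Variables (K : fieldExtType rat) (sqrt_p sqrt_qrs : K).
Hypotheses (sqrt_pE : sqrt_p ^+ 2 = p%:R) (sqrt_qrsE : sqrt_qrs ^+ 2 = (q * r * s)%:R).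
Hypothesis K_gen : <<1 & [:: sqrt_p; sqrt_qrs]>>%VS = fullv.
Hypotheses (s2 : chi s 2) (sp : ~~ chi s p) (not_both : chi s q || chi s r).
Hypotheses (pq : p != q) (pr : p != r) (qr : q != r).
Hypotheses (p_qr : chi p q (+) chi p r)
  (q_pr_or : (chi q p (+) chi q r) || (chi s q && chi s r)).

(** Both claims of the theorem give these hypotheses: they differ only in the way in
    which the last one is obtained. *)
Lemma polya_of_nonresidues : polya_field K.
Proof.
have s_neq l : (l = 3 %[mod 4])%N -> l != s.
  by move=> l4; apply/eqP => ls; rewrite ls s4 in l4.
have uniq_ps : uniq [:: p; q; r; s] by rewrite /= !inE !negb_or pq pr qr !s_neq.
have ps_pr : all prime [:: p; q; r; s] by rewrite /= p_prime q_prime r_prime s_prime.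
have qrsE : (\prod_(l <- [:: q; r; s]) l = q * r * s)%N.
  by rewrite !big_cons big_nil muln1 mulnA.
have pqrsE : (\prod_(l <- [:: p; q; r; s]) l = p * q * r * s)%N.
  by rewrite !big_cons big_nil muln1 !mulnA.
have irr (x : K) (ps : seq nat) : uniq ps -> all prime ps -> (0 < size ps)%N ->
    x ^+ 2 = (\prod_(l <- ps) l)%:R -> x \notin 1%VS.
  move=> ps_uniq ps_prime ps_gt0 xE; apply/negP => /(rational_sqrt _ _ _ xE)[z].
  by apply: squarefree_nonsquare; [apply: squarefree_prime_product|apply: prime_product_gt1].
have prodE : (sqrt_p * sqrt_qrs) ^+ 2 = (p * q * r * s)%:R.
  by rewrite exprMn sqrt_pE sqrt_qrsE -natrM !mulnA.
have sqrtO (x : K) (k : nat) : x ^+ 2 = k%:R -> exists c : ringOfIntegers K, c ^+ 2 = k%:R.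
  move=> xE; have xO : x \in @integer_pred K by apply: integer_sqrt; rewrite xE rpred_nat.
  by exists (RingOfIntegers xO); apply: val_inj; rewrite rmorphXn rmorph_nat.
have P_sqrt D : D \in [:: p; q * r * s; p * q * r * s]%N ->
    exists c : ringOfIntegers K, c ^+ 2 = D%:R.
  by rewrite !inE => /or3P[] /eqP ->; apply: sqrtO; eassumption.
have P_D D : D \in [:: p; q * r * s; p * q * r * s]%N -> assoc_square K D.
  by move=> /P_sqrt[c cE]; apply: assoc_square_sqrt cE.
have P_pell D : D \in [:: p; q * r * s; p * q * r * s]%N ->
    forall d1 d2 a b e, (d1 * d2 = D)%N -> (d1 * a ^ 2 = d2 * b ^ 2 + e)%N ->
    e = 1%N \/ e = 2%N -> assoc_square K (e * d1)%N.
  by move=> /P_sqrt[c cE] d1 d2 a b e; apply: assoc_square_represented cE _ _ _ _ _.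
have P2 := subgroup_two _ (assoc_squareM K) (assoc_square_cancel K) p q r s p_prime p4 P_D P_pell.
have [Pq Pr Ps] := subgroup_primes _ (assoc_squareM K) (assoc_square_cancel K) p q r s
  p_prime q_prime r_prime s_prime p4 q4 r4 s4 pq pr qr P_D P_pell s2 sp not_both p_qr q_pr_or.
apply: (biquadratic_polya K sqrt_p sqrt_qrs p (q * r * s) sqrt_pE sqrt_qrsE K_gen).
- by apply: (irr _ [:: p]) => //; rewrite /= ?p_prime // big_cons big_nil muln1.
- apply: (irr _ [:: q; r; s]) => //; rewrite ?qrsE //.
    by case/andP: uniq_ps.
  by case/andP: ps_pr.
- by apply: (irr _ [:: p; q; r; s]) => //; rewrite pqrsE.
- by rewrite prime_coprime // !Euclid_dvdM // !dvdn_prime2 // !negb_or pq pr s_neq.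
- by rewrite -modnMm -(modnMm q) q4 r4 s4.
- move=> l l_pr; rewrite !Euclid_dvdM // !dvdn_prime2 // -!orbA.
  by move=> /or4P[/eqP ->|/eqP ->|/eqP ->|/orP[] /eqP ->] //; apply: P_D; rewrite inE eqxx.
Qed.
End Main.

Theorem theorem1 (p q r s : nat)
  (p_prime : prime p) (q_prime : prime q) (r_prime : prime r) (s_prime : prime s)
  (p_mod4 : (p = 3 %[mod 4])%N) (q_mod4 : (q = 3 %[mod 4])%N)
  (r_mod4 : (r = 3 %[mod 4])%N) (qrs_mod4 : (q * r * s = 1 %[mod 4])%N)
  (not_both_one : ~ (legendre q%:Z s = 1 /\ legendre r%:Z s = 1))
  (K : fieldExtType rat) (sqrt_p sqrt_qrs : K)
  (sqrt_pE : sqrt_p ^+ 2 = p%:R) (sqrt_qrsE : sqrt_qrs ^+ 2 = (q * r * s)%:R)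
  (K_gen : <<1 & [:: sqrt_p; sqrt_qrs]>>%VS = fullv) :
  (legendre 2 s = -1 -> legendre p%:Z s <> legendre 2 s ->
   legendre (q * r)%:Z p = -1 -> legendre (p * r)%:Z q = -1 ->
   polya_field K)
  /\
  (legendre q%:Z s = -1 -> legendre r%:Z s = -1 ->
   legendre 2 s = -1 -> legendre p%:Z s <> legendre 2 s ->
   legendre (q * r)%:Z p = -1 ->
   polya_field K).
Proof.
have s4 : (s = 1 %[mod 4])%N.
  move: qrs_mod4; rewrite -modnMm -(modnMm q) q_mod4 r_mod4.
  by move: (s %% 4)%N (ltn_pmod s (isT : 0 < 4)%N) => [|[|[|[|]]]].
have s_ndvd l : prime l -> (l = 3 %[mod 4])%N -> ~~ (s %| Posz l)%Z.
  move=> l_pr l4; rewrite dvdzE /= dvdn_prime2 //.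
  by apply/eqP => sl; rewrite sl l4 in s4.
have not_both : chi s q || chi s r.
  apply/negPn; rewrite negb_or; apply/andP => [[nq nr]]; apply: not_both_one.
  by split; apply: legendre_not_nonres => //; apply: s_ndvd.
have main : legendre 2 s = -1 -> legendre p%:Z s <> legendre 2 s ->
    legendre (q * r)%:Z p = -1 ->
    (chi q p (+) chi q r) || (chi s q && chi s r) -> polya_field K.
  move=> s2 sp pqr q_pr_or.
  have [pq pr p_qr] := legendre_mul_nonres _ _ _ p_prime q_prime r_prime pqr.
  apply: (polya_of_nonresidues p q r s) sqrt_pE sqrt_qrsE K_gen _ _ _ _ _ _ _ _ => //.
  - exact: legendre_nonres.
  - by apply/negP => /eqP spE; apply: sp; rewrite spE s2.
  - by apply: contraTneq p_qr => ->; rewrite addbb.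
split=> [s2 sp pqr qpr|sq sr s2 sp pqr].
  apply: main => //; apply/orP; left.
  by have [] := legendre_mul_nonres _ _ _ q_prime p_prime r_prime qpr.
by apply: main => //; rewrite (legendre_nonres s q%:Z sq) (legendre_nonres s r%:Z sr) orbT.
Qed.
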